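(* Let $d\ge2$ be an integer. For every $\rho\in(0,1)$ there exists a constant $C_S(d,\rho)<\infty$, which increases with respect to $\rho$, such that for every integer $\ell\ge1$ with $\lfloor\rho|B_\ell|\rfloor\ge1$ and every $f:\Omega_\ell\to\mathbb{R}$, $$\left\langle\left(f-\langle f\rangle_{\ell,\rho}\right)^2\right\rangle_{\ell,\rho}\le C_S(d,\rho)\,\ell^2\sum_{e\in\mathbb{B}_\ell}\left\langle a_e\,(f^e-f)^2\right\rangle_{\ell,\rho}.$$
   Context: Let $B_\ell:=\{-\ell,\dots,\ell\}^d$ and let $\mathbb{B}_\ell$ be the set of unoriented edges $\{y,z\}$ with $y,z\in B_\ell$ and $|y-z|=1$ (Euclidean norm). Let $\Omega_\ell:=\{(x,\eta)\in B_\ell\times\{0,1\}^{B_\ell}:\eta(x)=1\}$. For $e\in\mathbb{B}_\ell$ and $x\in B_\ell$, $x^e:=y$ if $e=\{x,y\}$ and $x^e:=x$ if $x\notin e$; $\eta^e(z):=\eta(z^e)$; and for $f:\Omega_\ell\to\mathbb{R}$, $f^e(x,\eta):=f(x^e,\eta^e)$. Put $a_e(\eta):=1$ if $\eta^e\neq\eta$ and $a_e(\eta):=0$ otherwise. For $\rho\in[0,1]$, $\langle\cdot\rangle_{\ell,\rho}$ denotes the expectation with respect to the uniform probability measure on $$\left\{(x,\eta)\in\Omega_\ell:\ \sum_{z\in B_\ell}\eta(z)=\lfloor\rho|B_\ell|\rfloor\right\}.$$ *)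

(* Defs.v *)
From HB Require Import structures.
From mathcomp Require Import all_boot all_order all_algebra.
From mathcomp Require Import reals.

Set Implicit Arguments.
Unset Strict Implicit.
Unset Printing Implicit Defensive.
Import Order.TTheory GRing.Theory Num.Theory.
Local Open Scope ring_scope.

(* The box B_l = {-l, ..., l}^d.  To get a finType, each coordinate is stored  *)
(* shifted by l, as an element of {0, ..., 2l}; [box_coord] recovers the integer.  *)
Definition box (d l : nat) : finType := {ffun 'I_d -> 'I_(l.*2.+1)}.

Definition box_coord (d l : nat) (y : box d l) (i : 'I_d) : int :=
  (y i : nat)%:Z - l%:Z.

Definition eucl_dist (R : realType) (d l : nat) (y z : box d l) : R :=
  Num.sqrt (\sum_(i < d) (box_coord y i - box_coord z i)%:~R ^+ 2).

Definition edges (R : realType) (d l : nat) : {set {set box d l}} :=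
  [set [set p.1; p.2] | p : box d l * box d l & eucl_dist R p.1 p.2 == 1].

(* x^e.  For an edge e containing x, the y with e = {x, y} is unique.  *)
Definition swap_site (d l : nat) (e : {set box d l}) (x : box d l) : box d l :=
  if [pick y | e == [set x; y]] is Some y then y else x.

Definition config (d l : nat) : finType := {ffun box d l -> bool}.

Definition swap_config (d l : nat) (e : {set box d l}) (eta : config d l) :
  config d l := [ffun z => eta (swap_site e z)].

Definition Omega (d l : nat) : finType :=
  {w : box d l * config d l | w.2 w.1}.

Lemma swap_siteK (d l : nat) (e : {set box d l}) : involutive (swap_site e).
Proof.
move=> x; rewrite {2}/swap_site; case: pickP => [y /eqP def_e | e'x].
  rewrite /swap_site; case: pickP => [z /eqP e_yz | e'y].
    have: x \in [set y; z] by rewrite -e_yz def_e set21.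
    have: z \in [set x; y] by rewrite -def_e e_yz set22.
    by rewrite !inE => /orP[/eqP-> // | /eqP->] /orP[] /eqP.
  by have := e'y x; rewrite def_e setUC eqxx.
by rewrite /swap_site; case: pickP => // y; rewrite e'x.
Qed.

Lemma swap_Omega_subproof (d l : nat) (e : {set box d l}) (w : Omega d l) :
  swap_config e (val w).2 (swap_site e (val w).1).
Proof. by rewrite ffunE swap_siteK; exact: (valP w). Qed.

Definition swap_Omega (d l : nat) (e : {set box d l}) (w : Omega d l) :
  Omega d l :=
  exist (fun w : box d l * config d l => w.2 w.1)
    (swap_site e (val w).1, swap_config e (val w).2)
    (swap_Omega_subproof e w).

Definition exch_rate (R : realType) (d l : nat) (e : {set box d l})
  (eta : config d l) : R := (swap_config e eta != eta)%:R.

Definition particle_number (R : realType) (d l : nat) (rho : R) : int :=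
  Num.floor (rho * #|box d l|%:R).

Definition canonical_states (R : realType) (d l : nat) (rho : R) :
  {set Omega d l} :=
  [set w : Omega d l | (\sum_(z : box d l) ((val w).2 z : nat))%N%:Z
           == particle_number d l rho].

Definition expect (R : realType) (d l : nat) (rho : R) (g : Omega d l -> R) :
  R :=
  (\sum_(w in canonical_states d l rho) g w) / #|canonical_states d l rho|%:R.

(* Main.v *)
Require Import Defs.
From mathcomp Require Import all_boot all_order all_algebra all_fingroup.
From mathcomp Require Import reals ring lra zify.

Set Implicit Arguments.
Unset Strict Implicit.
Unset Printing Implicit Defensive.
Import Order.TTheory GRing.Theory Num.Theory.
Local Open Scope ring_scope.

(** The tagged particle never trades places with another particle directly:
a swap of the tag with an occupied site has rate 0.  Such a swap can only be
produced with the help of a hole, and the proof makes every configuration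
move along paths in which all elementary steps are allowed.

Mean field.  On a set S of configurations stable under all permutations of
the N sites, the variance is at most 1/(4N) times the energy of all
transpositions, summed over ordered pairs of sites ([transposition_gap]).
This is the gap of the random transposition walk.  It is proved by induction
on the set of sites being permuted, because the averages over the subgroups
fixing one more site generate, on functions of mean zero, a multiple of an
orthogonal projection ([sum_proj_le]).  A transposition of the tag and a
particle is then replaced by three moves through a hole taken uniformly at
random ([tag_swap_via]); a configuration has at least (1 - rho) N holes, and
this is where the factor 1/(1 - rho) comes from ([exchange_energy_le]).
There remain the swaps of two sites without the tag ([swap_energy]) and the
swaps of the tag with a hole ([jump_energy]), at arbitrary distance.

Reduction to lines.  Two sites are joined by changing one coordinate after
the other.  A swap without the tag factors through an intermediate site; when
the tag blocks that site, another one is used ([swap_energy_via]).  A jump of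
the tag factors through an intermediate site as well, using swaps of the hole
to clear the way ([jump_energy_via]).  As the intermediate points of a uniform
pair of sites are again uniform, the sums over all pairs reduce to sums over
pairs on coordinate lines, at the price of a constant that depends on d
([mix_sum_le]).

One line.  On a line, swapping two sites costs a bounded multiple of the
nearest-neighbour swaps between them; if the tag is on the way, the path runs
along the neighbouring parallel line, which exists because d >= 2
([swap_energy_line]).  To move the tag from one end to a hole at the other
end, the hole is first brought next to the tag, then the tag and the hole
travel together: the tag steps into the hole, and the hole goes around the tag
through the parallel line to get in front again.  The result is a cyclic
shift of the line, undone by the hole on its way back ([rot_backE],
[jump_energy_line]).

All paths have length O(l) and use every edge of the two parallel lines, and
every rung between them, a bounded number of times.  By the Cauchy-Schwarz inequality a pair on a line
costs O(l) times the energy of these two lines ([line_energy]).  Summing over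
the pairs of a line, normalised by the length of the line, gives the factor
l^2 of a diffusive relaxation time. *)

(** * Averages over permutations of a set of sites *)

Section SymMean.
Variables (R : realFieldType) (T W : finType) (to : {action {perm T} &-> W}).
Implicit Types (A B : {set T}) (s t : {perm T}) (f g : W -> R).

Definition sym_mean A f (w : W) : R := (#|A|`!%:R)^-1 * \sum_(s in Sym A) f (to w s).

Lemma SymP A s : reflect {in ~: A, forall x, s x = x} (s \in Sym A).
Proof.
rewrite inE; apply: (iffP idP) => [sA x|sA].
  by rewrite inE => xA; exact: out_perm sA xA.
by apply/subsetP=> x; rewrite inE; apply: contraR => xA; rewrite sA ?inE.
Qed.

Lemma tperm_Sym A x y : x \in A -> y \in A -> tperm x y \in Sym A.
Proof.
move=> xA yA; apply/SymP=> z; rewrite inE => zA.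
by rewrite tpermD //; apply: contraNneq zA => <-.
Qed.

Lemma eq_sym_mean A f g : f =1 g -> sym_mean A f =1 sym_mean A g.
Proof. by move=> fg w; rewrite /sym_mean; congr (_ * _); apply: eq_bigr. Qed.

Lemma sym_mean_act A f w s : s \in Sym A -> sym_mean A f (to w s) = sym_mean A f w.
Proof.
move=> sA; rewrite /sym_mean; congr (_ * _).
rewrite [RHS](reindex_inj (mulgI s)) /=; apply: eq_big => t; first by rewrite groupMl.
by rewrite actM.
Qed.

Lemma sym_mean_id A f w : {in Sym A, forall s, f (to w s) = f w} -> sym_mean A f w = f w.
Proof.
move=> fA; rewrite /sym_mean (eq_bigr (fun=> f w)) //.
rewrite sumr_const card_Sym -[f w *+ _]mulr_natl mulrA mulVf ?mul1r //.
by rewrite pnatr_eq0 -lt0n fact_gt0.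
Qed.

(** Averaging over Sym B already makes a function invariant under the smaller
group Sym A, so the larger group absorbs the smaller one. *)
Lemma sym_meanK A B f w : A \subset B -> sym_mean A (sym_mean B f) w = sym_mean B f w.
Proof.
move=> AB; apply: sym_mean_id => s sA; apply: sym_mean_act.
apply/SymP=> x; rewrite inE => xB; move/SymP: sA; apply.
by rewrite inE; apply: contraNN xB; exact: (subsetP AB).
Qed.

Lemma sym_mean_lin A f g w a :
  sym_mean A (fun w => f w + a * g w) w = sym_mean A f w + a * sym_mean A g w.
Proof. by rewrite /sym_mean big_split /= -mulr_sumr mulrDr mulrCA. Qed.

(** The coset decomposition of Sym A modulo the stabiliser of j, where the coset
of s is given by the preimage of j under s. *)
Lemma sym_mean_rec A j f w : j \in A ->
  #|A|%:R * sym_mean A f w = \sum_(k in A) sym_mean (A :\ j) f (to w (tperm j k)).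
Proof.
move=> jA; have cA : #|A| = #|A :\ j|.+1 by rewrite (cardsD1 j A) jA.
rewrite /sym_mean -mulr_sumr mulrA.
have -> : #|A|%:R * (#|A|`!%:R)^-1 = (#|A :\ j|`!%:R)^-1 :> R.
  rewrite cA factS natrM invfM mulrA mulfV ?mul1r //.
  by rewrite pnatr_eq0.
congr (_ * _).
rewrite (partition_big (fun s : {perm T} => (s^-1)%g j) (mem A)) /=; last first.
  by move=> s; rewrite -groupV inE => sA; rewrite (perm_closed _ sA).
apply: eq_bigr => k kA.
rewrite (reindex_inj (mulgI (tperm j k))) /=; apply: eq_big => s; last by rewrite actM.
rewrite groupMl ?tperm_Sym // invMg tpermV permM.
apply/andP/idP => [[sA /eqP sj]|sA].
  apply/SymP => x; rewrite !inE negb_and negbK => /orP[/eqP ->|xA].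
    have sjj : (s^-1)%g j = j by rewrite -[LHS](tpermK j k) sj tpermR.
    by rewrite -{1}sjj permKV.
  by move/SymP: sA; apply; rewrite inE.
have sjj : (s^-1)%g j = j.
  move: sA; rewrite -groupV => /SymP; apply.
  by rewrite !inE eqxx.
split; last by rewrite sjj tpermL.
apply/SymP=> x; rewrite inE => xA; move/SymP: sA; apply.
by rewrite !inE negb_and xA orbT.
Qed.

End SymMean.

(** * The spectral gap of random transpositions *)

Section Gap.
Variables (R : realFieldType) (T W : finType) (to : {action {perm T} &-> W}).
Variable S : {set W}.
Hypothesis S_inv : forall w s, (to w s \in S) = (w \in S).
Implicit Types (A B : {set T}) (s t : {perm T}) (f g : W -> R).
Local Notation mean := (sym_mean to).

Lemma sum_act g s : \sum_(w in S) g (to w s) = \sum_(w in S) g w.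
Proof.
rewrite [RHS](reindex_inj (act_inj to s)) /=; apply: eq_bigl => w.
by rewrite S_inv.
Qed.

Lemma sym_mean_adj A f g :
  \sum_(w in S) mean A f w * g w = \sum_(w in S) f w * mean A g w.
Proof.
have E h k : \sum_(w in S) mean A h w * k w
    = (#|A|`!%:R)^-1 * \sum_(s in Sym A) \sum_(w in S) h (to w s) * k w.
  rewrite mulr_sumr.
  under [RHS]eq_bigr do rewrite mulr_sumr.
  rewrite exchange_big; apply: eq_bigr => w wS.
  by rewrite /sym_mean mulr_sumr mulr_suml; apply: eq_bigr => s _; rewrite mulrA.
rewrite E; under [RHS]eq_bigr do rewrite mulrC.
rewrite E; congr (_ * _).
rewrite (reindex_inj invg_inj) /=; apply: eq_big => s; first by rewrite groupV.
move=> _; rewrite -(sum_act _ s); apply: eq_bigr => w _.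
by rewrite mulrC -actM mulgV act1.
Qed.

(** Write P_i for the average over Sym (A :\ i) and n = m.+2 for the size of A.
On functions whose average over Sym A vanishes, [sym_mean_rec] gives
(n - 1) P_i P_j f = - P_j f \o tperm j i for i != j, and summing over i shows
that F = sum_i P_i satisfies (n - 1) F^2 = n F.  Hence F is n / (n - 1) times
an orthogonal projection, which bounds its quadratic form. *)
Lemma sum_proj_le A m f : #|A| = m.+2 -> (forall w, mean A f w = 0) ->
  m.+1%:R * \sum_(i in A) \sum_(w in S) mean (A :\ i) f w * f w
   <= m.+2%:R * \sum_(w in S) f w ^+ 2.
Proof.
move=> cA f0.
have PP j w : j \in A ->
    m.+1%:R * \sum_(i in A) mean (A :\ i) (mean (A :\ j) f) w = m.+2%:R * mean (A :\ j) f w.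
  move=> jA.
  have z : \sum_(k in A) mean (A :\ j) f (to w (tperm j k)) = 0.
    by rewrite -sym_mean_rec // f0 mulr0.
  rewrite (bigD1 j) //= sym_meanK // mulrDr mulr_sumr.
  have -> : \sum_(i in A | i != j) m.+1%:R * mean (A :\ i) (mean (A :\ j) f) w
      = \sum_(i in A | i != j) - mean (A :\ j) f (to w (tperm j i)).
    apply: eq_bigr => i /andP[iA ij].
    have cAi : #|A :\ i| = m.+1 by move: cA; rewrite (cardsD1 i A) iA => -[].
    rewrite -cAi (@sym_mean_rec _ _ _ to (A :\ i) j); last by rewrite !inE eq_sym ij.
    under eq_bigr => k _ do rewrite sym_meanK ?(setSD _ (subsetDl _ _)) //.
    move: z; rewrite (bigD1 i) //= addrC => /eqP; rewrite addr_eq0 => /eqP <-.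
    by apply: eq_bigl => k; rewrite !inE andbC.
  rewrite sumrN; move: z; rewrite (bigD1 j) //= tperm1 act1 addrC => /eqP.
  rewrite addr_eq0 => /eqP ->.
  by rewrite opprK -[in RHS]addn1 natrD; ring.
pose F w := \sum_(i in A) mean (A :\ i) f w.
have FF : m.+1%:R * \sum_(w in S) F w ^+ 2 = m.+2%:R * \sum_(w in S) F w * f w.
  transitivity (m.+1%:R * \sum_(i in A) \sum_(j in A) \sum_(w in S) f w * mean (A :\ i) (mean (A :\ j) f) w).
    congr (_ * _); under [RHS]eq_bigr => i iA.
      under eq_bigr => j jA do rewrite -sym_mean_adj.
      over.
    under [RHS]eq_bigr do rewrite exchange_big /=.
    rewrite exchange_big; apply: eq_bigr => w _.
    rewrite expr2 /F mulr_suml; apply: eq_bigr => i _.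
    by rewrite mulr_sumr.
  rewrite exchange_big /= mulr_sumr.
  transitivity (\sum_(j in A) m.+2%:R * \sum_(w in S) mean (A :\ j) f w * f w).
    apply: eq_bigr => j jA; rewrite exchange_big /= !mulr_sumr; apply: eq_bigr => w _.
    by rewrite -mulr_sumr mulrCA PP // mulrCA [f _ * _]mulrC.
  rewrite -mulr_sumr exchange_big; congr (_ * _).
  by apply: eq_bigr => w _; rewrite /F mulr_suml.
rewrite exchange_big /=.
under eq_bigr do rewrite -mulr_suml -/(F _).
have m0 : (0 : R) < m.+1%:R by rewrite ltr0n.
have n0 : (0 : R) < m.+2%:R by rewrite ltr0n.
(* f minus its projection has a nonnegative square norm; FF removes the
   quadratic term in F *)
have : 0 <= \sum_(w in S) (m.+2%:R * f w - m.+1%:R * F w) ^+ 2.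
  by apply: sumr_ge0 => w _; apply: sqr_ge0.
rewrite (eq_bigr (fun w => m.+2%:R ^+ 2 * f w ^+ 2 - 2 * m.+2%:R * m.+1%:R * (F w * f w)
   + m.+1%:R ^+ 2 * F w ^+ 2)); last by move=> w _; ring.
rewrite big_split sumrB /= -!mulr_sumr.
set X := \sum_(w in S) f w ^+ 2; set Y := \sum_(w in S) F w * f w in FF *.
set Z := \sum_(w in S) F w ^+ 2 in FF *.
rewrite [m.+1%:R ^+ 2 * Z](_ : _ = m.+1%:R * m.+2%:R * Y); last by rewrite -mulrA -FF; ring.
move=> H; rewrite -subr_ge0 -(pmulr_rge0 _ n0).
by apply: le_trans H _; rewrite le_eqVlt; apply/orP; left; apply/eqP; ring.
Qed.

Definition transposition_energy A f : R :=
  \sum_(x in A) \sum_(y in A) \sum_(w in S) (f (to w (tperm x y)) - f w) ^+ 2.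

Lemma transposition_energy_ge0 A f : 0 <= transposition_energy A f.
Proof. by do 3 (apply: sumr_ge0 => ? _); exact: sqr_ge0. Qed.

(** A pair x != y survives the removal of i unless i is x or y. *)
Lemma sum_transposition_energyD1 A m f : #|A| = m.+2 ->
  \sum_(i in A) transposition_energy (A :\ i) f = m%:R * transposition_energy A f.
Proof.
move=> cA; pose D x y := \sum_(w in S) (f (to w (tperm x y)) - f w) ^+ 2.
transitivity (\sum_(i in A) \sum_(x in A) \sum_(y in A) (((x != i) && (y != i))%:R * D x y)).
  apply: eq_bigr => i iA; rewrite [RHS](bigD1 i) //= [X in X + _]big1 ?add0r; last first.
    by move=> y _; rewrite eqxx mul0r.
  apply: eq_big => x; first by rewrite !inE andbC.
  rewrite !inE => /andP[xi xA]; rewrite [RHS](bigD1 i) //= eqxx andbF mul0r add0r.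
  by apply: eq_big => y; rewrite !inE andbC // => /andP[_ ->]; rewrite xi mul1r.
rewrite exchange_big mulr_sumr; apply: eq_bigr => x xA.
rewrite exchange_big mulr_sumr; apply: eq_bigr => y yA.
rewrite -mulr_suml -/(D x y); have [->|xy] := eqVneq x y.
  have -> : D y y = 0.
    by apply: big1 => w _; rewrite tperm1 act1 subrr expr0n.
  by rewrite !mulr0.
congr (_ * _); rewrite -natr_sum; congr _%:R.
rewrite (bigD1 x) //= eqxx add0n (bigD1 y) ?yA ?eqxx 1?eq_sym //= andbF add0n.
rewrite (eq_bigr (fun=> 1%N)); last first.
  by move=> i /andP[/andP[_ ix] iy]; rewrite eq_sym ix eq_sym iy.
rewrite sum1dep_card; move: cA; rewrite (cardsD1 x A) xA (cardsD1 y (A :\ x)) !inE yA andbT eq_sym xy.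
case=> <-; apply: eq_card => i; rewrite !inE.
by case: (i \in A); case: (i == x); case: (i == y).
Qed.

Lemma sym_mean_small A f w : (#|A| <= 1)%N -> mean A f w = f w.
Proof.
move=> A1; apply: sym_mean_id => s sA.
have -> : s = 1%g; last by rewrite act1.
apply/permP => x; rewrite perm1; have [xA|xA] := boolP (x \in A).
  by apply: (card_le1_eqP A1) => //; rewrite inE in sA; rewrite (perm_closed _ sA).
by move/SymP: sA; apply; rewrite inE.
Qed.

Lemma transposition_gap2 A f : #|A| = 2%N ->
  4 * #|A|%:R * \sum_(w in S) (f w - mean A f w) ^+ 2 <= transposition_energy A f.
Proof.
move=> cA; have /cards2P[x [y [xy def_A]]] : #|A| == 2%N by rewrite cA.
have M w : mean A f w = (f w + f (to w (tperm x y))) / 2.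
  have xA : x \in A by rewrite def_A set21.
  have : #|A|%:R * mean A f w = f w + f (to w (tperm x y)).
    rewrite (sym_mean_rec _ _ _ xA) def_A big_setU1 ?inE //= big_set1 tperm1 act1.
    have c1 : (#|[set x; y] :\ x| <= 1)%N.
      by rewrite -def_A; move: cA; rewrite (cardsD1 x A) xA add1n => -[->].
    by rewrite !sym_mean_small.
  by rewrite cA => <-; field.
rewrite /transposition_energy cA def_A !(big_setU1, big_set1) ?inE //=.
have d0 z : \sum_(w in S) (f (to w (tperm z z)) - f w) ^+ 2 = 0.
  by apply: big1 => w _; rewrite tperm1 act1 subrr expr0n.
rewrite !d0 [tperm y x]tpermC add0r addr0 -mulr2n.
rewrite le_eqVlt; apply/orP; left; apply/eqP.
rewrite mulr_sumr -sumrMnl; apply: eq_bigr => w _; rewrite -def_A M.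
by field.
Qed.

(** Split the variance over Sym A into the variance over Sym (A :\ i) and the
variance of the conditional mean, and average over i in A: the induction
hypothesis bounds the first part, [sum_proj_le] absorbs the second one, and the
constants are such that the gap does not deteriorate from one size to the
next.  The bound obtained carries a factor #|A| - 2, so sets of two elements are
treated directly. *)
Theorem transposition_gap A f :
  4 * #|A|%:R * \sum_(w in S) (f w - mean A f w) ^+ 2 <= transposition_energy A f.
Proof.
have [n] := ubnP #|A|; elim: n A f => // n IH A f ltA.
have [A1|A2|A2] := ltngtP #|A| 2%N; last exact: transposition_gap2.
  rewrite big1 ?mulr0 ?transposition_energy_ge0 // => w _.
  by rewrite sym_mean_small ?subrr ?expr0n.
have [m cA] : exists m, #|A| = m.+3.
  by case: #|A| A2 => [|[|[|m]]] // _; exists m.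
pose f0 w := f w - mean A f w.
have mean_f0 B w : B \subset A -> mean B f0 w = mean B f w - mean A f w.
  move=> BA; rewrite (@eq_sym_mean _ _ _ to _ _ (fun w => f w + -1 * mean A f w)); last first.
    by move=> v; rewrite mulN1r.
  by rewrite sym_mean_lin sym_meanK // mulN1r.
have f00 w : mean A f0 w = 0 by rewrite mean_f0 // subrr.
have Y := sum_proj_le cA f00.
set X := \sum_(w in S) f0 w ^+ 2 in Y.
have E i : i \in A ->
    4 * m.+2%:R * (X - \sum_(w in S) mean (A :\ i) f0 w * f0 w) <= transposition_energy (A :\ i) f.
  move=> iA; have cAi : #|A :\ i| = m.+2 by move: cA; rewrite (cardsD1 i A) iA => -[].
  apply: le_trans (IH (A :\ i) f _); last by rewrite cAi; move: ltA; rewrite cA.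
  rewrite cAi le_eqVlt; apply/orP; left; apply/eqP; congr (_ * _).
  transitivity (\sum_(w in S) (f0 w - mean (A :\ i) f0 w) ^+ 2); last first.
    by apply: eq_bigr => w _; rewrite mean_f0 ?subsetDl // /f0; congr (_ ^+ 2); ring.
  have P2 : \sum_(w in S) mean (A :\ i) f0 w ^+ 2 = \sum_(w in S) mean (A :\ i) f0 w * f0 w.
    under [LHS]eq_bigr do rewrite expr2.
    rewrite -sym_mean_adj; apply: eq_bigr => w _.
    by rewrite sym_meanK.
  rewrite [RHS](eq_bigr (fun w => f0 w ^+ 2 - 2 * (mean (A :\ i) f0 w * f0 w)
      + mean (A :\ i) f0 w ^+ 2)); last by move=> w _; ring.
  by rewrite big_split sumrB /= P2 -mulr_sumr -/X; ring.
have {E} := ler_sum (index_enum T) E; rewrite (sum_transposition_energyD1 _ cA) -mulr_sumr sumrB sumr_const cA.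
set V := \sum_(i in A) _ in Y *.
rewrite -mulr_natl -/X => H.
have m0 : (0 : R) < m.+1%:R by rewrite ltr0n.
rewrite -(ler_pM2l m0); apply: le_trans H.
move: Y m0; rewrite -!natr1 => Y m0.
rewrite mulrBr [X in _ <= _ - X](_ : _ = 4 * ((m%:R + 1 + 1) * V)); last by ring.
by rewrite -subr_ge0; move: Y; rewrite -subr_ge0; move: X V => X V; nra.
Qed.
End Gap.

(** * Energies of permutations on events *)

Section Minkowski.
Variables (R : rcfType) (I : finType) (P : pred I).
Implicit Types a b : I -> R.

Lemma sum_sqr_ge0 a : 0 <= \sum_(i | P i) a i ^+ 2.
Proof. by apply: sumr_ge0 => i _; apply: sqr_ge0. Qed.

(** Proved together with the Cauchy-Schwarz inequality it rests on, in the
form of Lagrange's identity. *)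
Lemma minkowski a b : Num.sqrt (\sum_(i | P i) (a i + b i) ^+ 2)
  <= Num.sqrt (\sum_(i | P i) a i ^+ 2) + Num.sqrt (\sum_(i | P i) b i ^+ 2).
Proof.
have [A0 B0] := (sum_sqr_ge0 a, sum_sqr_ge0 b).
set A := \sum_(i | P i) a i ^+ 2 in A0 *; set B := \sum_(i | P i) b i ^+ 2 in B0 *.
have [sA sB] := (sqrtr_ge0 A, sqrtr_ge0 B).
suff H : \sum_(i | P i) (a i + b i) ^+ 2 <= (Num.sqrt A + Num.sqrt B) ^+ 2.
  by apply: le_trans (ler_wsqrtr H) _; rewrite sqrtr_sqr ger0_norm ?addr_ge0.
pose C := \sum_(i | P i) a i * b i.
have -> : \sum_(i | P i) (a i + b i) ^+ 2 = A + C *+ 2 + B.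
  by rewrite -sumrMnl -!big_split; apply: eq_bigr => i _; rewrite sqrrD.
rewrite sqrrD !sqr_sqrtr // lerD2r lerD2l lerMn2r /=.
apply: le_trans (ler_norm C) _; rewrite -(@ler_pXn2r _ 2) ?nnegrE ?mulr_ge0 //.
rewrite real_normK ?num_real // exprMn !sqr_sqrtr // -subr_ge0.
have : 0 <= \sum_(i | P i) \sum_(j | P j) (a i * b j - a j * b i) ^+ 2.
  by apply: sumr_ge0 => i _; exact: sum_sqr_ge0.
have -> : \sum_(i | P i) \sum_(j | P j) (a i * b j - a j * b i) ^+ 2 = (A * B - C ^+ 2) *+ 2.
  transitivity (\sum_(i | P i) \sum_(j | P j) (a i ^+ 2 * b j ^+ 2)
     + \sum_(i | P i) \sum_(j | P j) (b i ^+ 2 * a j ^+ 2)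
     - (\sum_(i | P i) \sum_(j | P j) (a i * b i) * (a j * b j)) *+ 2).
    rewrite -sumrMnl -big_split -sumrB; apply: eq_bigr => i _ /=.
    by rewrite -sumrMnl -big_split -sumrB; apply: eq_bigr => j _ /=; ring.
  by rewrite -!big_distrlr /= -/A -/B -/C; ring.
by rewrite pmulrn_lge0.
Qed.
End Minkowski.

Section Energy.
Variables (R : rcfType) (T W : finType) (to : {action {perm T} &-> W}).
Variable S : {set W}.
Hypothesis S_inv : forall w s, (to w s \in S) = (w \in S).
Variable f : W -> R.
Implicit Types (P Q : pred W) (s t : {perm T}).

(** The L2 norm on P of the variation of f along s.  Working with norms instead
of their squares makes the cost of a product of permutations at most the sum
of the costs ([energy_mul]), so that Cauchy-Schwarz is applied only once, at
the end of a path. *)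
Definition energy P s : R := Num.sqrt (\sum_(w in S | P w) (f (to w s) - f w) ^+ 2).

Lemma energy_ge0 P s : 0 <= energy P s. Proof. exact: sqrtr_ge0. Qed.

Lemma sqr_energy P s : energy P s ^+ 2 = \sum_(w in S | P w) (f (to w s) - f w) ^+ 2.
Proof. by rewrite sqr_sqrtr // sum_sqr_ge0. Qed.

Lemma energy1 P : energy P 1%g = 0.
Proof. by rewrite /energy big1 ?sqrtr0 // => w _; rewrite act1 subrr expr0n. Qed.

Lemma sum_act_le P Q s (g : W -> R) : (forall w, 0 <= g w) ->
  (forall w, P w -> Q (to w s)) ->
  \sum_(w in S | P w) g (to w s) <= \sum_(w in S | Q w) g w.
Proof.
move=> g0 PQ; rewrite [leRHS](reindex_inj (act_inj to s)) /=.
under [leRHS]eq_bigl do rewrite S_inv.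
rewrite [leRHS](bigID P) /= -[leLHS]addr0 lerD ?sumr_ge0 //.
rewrite (eq_bigl (fun w => (w \in S) && Q (to w s) && P w)) // => w.
by case: (P w) (PQ w) => [->|_] //; rewrite ?andbF ?andbT.
Qed.

Lemma energy_sub_fix P Q s : (forall w, P w -> Q w \/ to w s = w) -> energy P s <= energy Q s.
Proof.
move=> PQ; rewrite ler_wsqrtr // big_mkcond [leRHS]big_mkcond; apply: ler_sum => w _.
case: (w \in S) => //=; case: (boolP (P w)) => [/PQ[->//|->]|_]; last by case: ifP => // _; apply: sqr_ge0.
by rewrite subrr expr0n /=; case: ifP.
Qed.

Lemma energy_sub P Q s : (forall w, P w -> Q w) -> energy P s <= energy Q s.
Proof. by move=> PQ; apply: energy_sub_fix => w /PQ; left. Qed.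

(** The triangle inequality along a path; the event has to be transported by the
first move, and this is how the allowed steps are tracked. *)
Lemma energy_mul P Q s t : (forall w, P w -> Q (to w s)) -> energy P (s * t)%g <= energy P s + energy Q t.
Proof.
move=> PQ; rewrite /energy.
rewrite (eq_bigr (fun w => (f (to w s) - f w + (f (to (to w s) t) - f (to w s))) ^+ 2)); last first.
  by move=> w _; rewrite actM; congr (_ ^+ 2); ring.
apply: le_trans (minkowski _ _ _) _; rewrite lerD2l ler_wsqrtr //.
by apply: (sum_act_le (g := fun w => (f (to w t) - f w) ^+ 2)) => // w; apply: sqr_ge0.
Qed.

Lemma energy_inv P Q s : (forall w, P w -> Q (to w s)) -> energy P s <= energy Q s^-1%g.
Proof.
move=> PQ; rewrite ler_wsqrtr //.
rewrite (eq_bigr (fun w => (f (to (to w s) s^-1%g) - f (to w s)) ^+ 2)); last first.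
  by move=> w _; rewrite actK -[RHS]sqrrN opprB.
by apply: (sum_act_le (g := fun w => (f (to w s^-1%g) - f w) ^+ 2)) => // w; apply: sqr_ge0.
Qed.

Lemma energy_split P Q s : energy P s <= energy (predI P Q) s + energy (predD P Q) s.
Proof.
have -> : energy P s = Num.sqrt (energy (predI P Q) s ^+ 2 + energy (predD P Q) s ^+ 2).
  rewrite !sqr_energy /energy (bigID Q) /=; congr (Num.sqrt (_ + _)); apply: eq_bigl => w /=.
    by rewrite andbA.
  by rewrite -andbA [P w && _]andbC.
have [I0 D0] := (energy_ge0 (predI P Q) s, energy_ge0 (predD P Q) s).
rewrite -[leRHS]ger0_norm ?addr_ge0 // -sqrtr_sqr ler_wsqrtr // sqrrD lerD2r.
by rewrite lerDl mulrn_wge0 // mulr_ge0.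
Qed.
End Energy.

(** * Configurations with a tagged particle *)

Section TaggedStates.
Variable T : finType.

Definition tagged : finType := {w : T * {ffun T -> bool} | w.2 w.1}.
Implicit Types (w : tagged) (s : {perm T}).

Definition tag w : T := (val w).1.
Definition occ w : {ffun T -> bool} := (val w).2.

Lemma move_subproof w s : ([ffun z => occ w (s^-1%g z)] : {ffun T -> bool}) (s (tag w)).
Proof. by rewrite ffunE permK; exact: (valP w). Qed.

Definition move w s : tagged :=
  exist (fun w : T * {ffun T -> bool} => w.2 w.1)
    (s (tag w), [ffun z => occ w (s^-1%g z)]) (move_subproof w s).

Lemma tagged_eq w w' : tag w = tag w' -> occ w =1 occ w' -> w = w'.
Proof.
move=> eq_tag /ffunP eq_occ; apply: val_inj.
by rewrite [val w]surjective_pairing [val w']surjective_pairing -/(tag w) -/(occ w) eq_tag eq_occ.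
Qed.

Lemma tag_move w s : tag (move w s) = s (tag w). Proof. by []. Qed.

Lemma occ_move w s z : occ (move w s) (s z) = occ w z.
Proof. by rewrite /occ /= ffunE permK. Qed.

Lemma occ_moveV w s z : occ (move w s) z = occ w (s^-1%g z).
Proof. by rewrite /occ /= ffunE. Qed.

Lemma move1 : move^~ 1%g =1 id.
Proof.
by move=> w; apply: tagged_eq => [|z]; rewrite ?tag_move ?occ_moveV ?invg1 perm1.
Qed.

Lemma moveM w : act_morph move w.
Proof.
move=> s t; apply: tagged_eq => [|z]; first by rewrite !tag_move permM.
by rewrite !occ_moveV invMg permM.
Qed.

Definition move_action := TotalAction move1 moveM.

End TaggedStates.

(** * Swaps of untagged sites along paths *)

Section TaggedEnergy.
Variables (R : rcfType) (T : finType).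
Local Notation to := (move_action T).
Variable S : {set tagged T}.
Hypothesis S_inv : forall w s, (to w s \in S) = (w \in S).
Variable f : tagged T -> R.
Implicit Types (p : pred T) (P : pred (tagged T)) (x y z : T) (s t : {perm T}).
Local Notation en := (energy to S f).

(** Restricting to the event that exactly one of x and y is occupied is the
factor a_e of the Dirichlet form. *)
Definition edge_energy x y : R := en (fun w => occ w x != occ w y) (tperm x y).

Definition hole_at x y (w : tagged T) := (tag w == x) && ~~ occ w y.

Lemma occ_tag (w : tagged T) : occ w (tag w). Proof. exact: (valP w). Qed.

Lemma edge_energy_ge0 x y : 0 <= edge_energy x y. Proof. exact: energy_ge0. Qed.

(** A swap is free when both sites have the same content and neither carries the
tag, since it does not change the configuration.  Only the swap of the tag
with another particle is excluded. *)
Lemma energy_edge P x y :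
    (forall w, P w -> (tag w != x) && (tag w != y) || (occ w x != occ w y)) ->
  en P (tperm x y) <= edge_energy x y.
Proof.
move=> Pxy; apply: energy_sub_fix => w /Pxy.
case: (eqVneq (occ w x) (occ w y)) => [eq_occ|ne _]; last by left.
rewrite /= orbF => /andP[wx wy]; right.
apply: tagged_eq => [|z]; first by rewrite tag_move tpermD // eq_sym.
by rewrite occ_moveV tpermV; case: tpermP => [->|->|] //; rewrite eq_occ.
Qed.

(** Moves away from the tag keep it in place, so an event that only sees the
position of the tag is preserved all along the path. *)
Definition tag_energy p s : R := en (fun w => p (tag w)) s.

Lemma tag_energy_mul p s t : (forall z, p z -> s z = z) ->
  tag_energy p (s * t)%g <= tag_energy p s + tag_energy p t.
Proof. by move=> ps; apply: energy_mul => // w pw; rewrite tag_move ps. Qed.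

Lemma tag_energy_edge p x y : ~~ p x -> ~~ p y -> tag_energy p (tperm x y) <= edge_energy x y.
Proof.
move=> px py; apply: energy_edge => w pw.
have ne z : ~~ p z -> tag w != z by apply: contraNneq => <-.
by rewrite !ne.
Qed.

Lemma tperm_off p x y : ~~ p x -> ~~ p y -> forall z, p z -> tperm x y z = z.
Proof.
by move=> px py z pz; rewrite tpermD //; apply: contraTneq pz => <-.
Qed.

(** The transposition of x and z is the conjugate by tperm x y of the one of
y and z. *)
Lemma tag_energy_conj p x y z : ~~ p x -> ~~ p y -> ~~ p z -> x != z -> y != z ->
  tag_energy p (tperm x z) <= 2 * tag_energy p (tperm x y) + tag_energy p (tperm y z).
Proof.
move=> px py pz xz yz.
have -> : tperm x z = (tperm x y * (tperm y z * tperm x y))%g.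
  rewrite -{1}[tperm x y]tpermV -[RHS]/(tperm y z ^ tperm x y)%g tpermJ tpermR.
  by rewrite tpermD.
apply: le_trans (tag_energy_mul _ (tperm_off px py)) _.
rewrite mulrDl mul1r -addrA lerD2l addrC.
exact: tag_energy_mul (tperm_off py pz).
Qed.

(** Carry the content of the last site down the path and back: by iterated
conjugation each edge is used at most twice. *)
Lemma tag_energy_path p (x : nat -> T) n :
    (forall i, (i <= n)%N -> ~~ p (x i)) ->
    (forall i j, (i <= n)%N -> (j <= n)%N -> x i = x j -> i = j) ->
  tag_energy p (tperm (x 0) (x n)) <= 2 * \sum_(i < n) edge_energy (x i) (x i.+1).
Proof.
elim: n => [|n IH] px x_inj; first by rewrite tperm1 /tag_energy energy1 big_ord0 mulr0.
have {}IH := IH (fun i le_in => px i (leqW le_in)) (fun i j le_in le_jn =>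
   x_inj i j (leqW le_in) (leqW le_jn)).
have pn1 := px _ (leqnn n.+1); have pn := px _ (leqnSn n); have p0 := px _ (leq0n _).
rewrite big_ord_recr mulrDr /=.
have e0 : 0 <= edge_energy (x n) (x n.+1) by exact: edge_energy_ge0.
have En : tag_energy p (tperm (x n.+1) (x n)) <= edge_energy (x n) (x n.+1).
  by rewrite tpermC tag_energy_edge.
case: n => [|n] in IH px x_inj pn pn1 e0 En *.
  by rewrite big_ord0 mulr0 add0r tpermC (le_trans En) // ler_peMl // ler1n.
rewrite tpermC; apply: le_trans (tag_energy_conj (y := x n.+1) _ _ _ _ _) _ => //.
- by apply/eqP => /x_inj; rewrite leqnn => /(_ isT isT).
- by apply/eqP => /x_inj; rewrite leqnSn => /(_ isT isT).
rewrite addrC lerD //; first by rewrite tpermC.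
by rewrite ler_pM2l.
Qed.

Lemma tag_energy_detour p x y x' y' : uniq [:: x; y; x'; y'] ->
    ~~ p x -> ~~ p y -> ~~ p x' -> ~~ p y' ->
  tag_energy p (tperm x y) <=
  2 * edge_energy x x' + 2 * edge_energy y y' + tag_energy p (tperm x' y').
Proof.
rewrite /= !inE !negb_or andbT => /and3P[/and3P[xy xx' xy'] /andP[yx' yy'] x'y'] px py px' py'.
apply: le_trans (tag_energy_conj (y := x') px px' py xy _) _; first by rewrite eq_sym.
rewrite -addrA lerD //; first by rewrite ler_pM2l // tag_energy_edge.
rewrite [tperm x' y]tpermC.
apply: le_trans (tag_energy_conj (y := y') py py' px' yx' _) _; first by rewrite eq_sym.
by rewrite [tperm y' _]tpermC lerD // ler_pM2l // tag_energy_edge.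
Qed.

End TaggedEnergy.

(** * Moving the tag along a line with the help of a hole *)

Section Ladder.
Variables (R : rcfType) (T : finType).
Local Notation to := (move_action T).
Variable S : {set tagged T}.
Hypothesis S_inv : forall w s, (to w s \in S) = (w \in S).
Variable f : tagged T -> R.
Implicit Types (p : pred T) (P : pred (tagged T)) (x : nat -> T) (s t : {perm T}).
Local Notation en := (energy to S f).
Local Notation edge_en := (edge_energy S f).
Local Notation tag_en := (tag_energy S f).

Definition swap_energy (y z : T) : R := tag_en [pred t | (t != y) && (t != z)] (tperm y z).

Definition jump_energy (y z : T) : R := en (hole_at y z) (tperm y z).

(** Two disjoint parallel paths; the rungs join x i to x' i. *)
Definition ladder n (x x' : nat -> T) :=
  [/\ forall i j, (i <= n)%N -> (j <= n)%N -> x i = x j -> i = j,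
      forall i j, (i <= n)%N -> (j <= n)%N -> x' i = x' j -> i = j
    & forall i j, (i <= n)%N -> (j <= n)%N -> x i != x' j].

Definition ladder_cost n (x x' : nat -> T) (b : nat -> R) :=
  [/\ forall i, (i < n)%N -> edge_en (x i) (x i.+1) <= b i,
      forall i, (i < n)%N -> edge_en (x' i) (x' i.+1) <= b i
    & forall i, (i <= n)%N -> edge_en (x i) (x' i) <= b i].

Lemma ladder_le n m x x' : (n <= m)%N -> ladder m x x' -> ladder n x x'.
Proof.
by move=> nm [h1 h2 h3]; split=> i j /leq_trans/(_ nm) im /leq_trans/(_ nm) jm;
  [apply: h1|apply: h2|apply: h3].
Qed.

Lemma ladder_cost_le n m x x' b :
  (n <= m)%N -> ladder_cost m x x' b -> ladder_cost n x x' b.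
Proof.
by move=> nm [h1 h2 h3]; split=> i /leq_trans/(_ nm) im; [apply: h1|apply: h2|apply: h3].
Qed.

Lemma ladder_shift k n x x' : ladder (k + n) x x' ->
  ladder n (fun i => x (k + i)%N) (fun i => x' (k + i)%N).
Proof.
by move=> [h1 h2 h3]; split=> i j le_in le_jn; [move/h1|move/h2|apply: h3];
  rewrite ?leq_add2l // => /(_ le_in le_jn)/addnI.
Qed.

Lemma ladder_cost_shift k n x x' b : ladder_cost (k + n) x x' b ->
  ladder_cost n (fun i => x (k + i)%N) (fun i => x' (k + i)%N) (fun i => b (k + i)%N).
Proof.
by move=> [h1 h2 h3]; split=> i lt_in; [rewrite addnS; apply: h1|rewrite addnS; apply: h2|apply: h3];
  rewrite ?ltn_add2l ?leq_add2l.
Qed.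

Lemma ladder_cost_ge0 n x x' b i : ladder_cost n x x' b -> (i <= n)%N -> 0 <= b i.
Proof. by move=> [_ _ h] /h; apply: le_trans; apply: edge_energy_ge0. Qed.

(** The swap runs along x', so that the tag may sit in the middle of x. *)
Lemma tag_energy_ladder p n x x' b : (0 < n)%N -> ladder n x x' -> ladder_cost n x x' b ->
    ~~ p (x 0) -> ~~ p (x n) -> (forall i, (i <= n)%N -> ~~ p (x' i)) ->
  tag_en p (tperm (x 0) (x n)) <= 2 * b 0 + 2 * b n + 2 * \sum_(i < n) b i.
Proof.
move=> n0 [x_inj x'_inj xx'] [cx cx' cxx'] p0 pn px'.
apply: le_trans (tag_energy_detour S_inv f (x' := x' 0) (y' := x' n) _ p0 pn (px' _ _) (px' _ _)) _ => //.
  rewrite /= !inE !negb_or !xx' // !andbT /=; apply/andP; split; apply/eqP.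
    by move/x_inj => /(_ isT (leqnn _)) n0'; rewrite -n0' in n0.
  by move/x'_inj => /(_ isT (leqnn _)) n0'; rewrite -n0' in n0.
rewrite !lerD ?ler_pM2l ?cxx' //.
apply: le_trans (tag_energy_path S_inv f px' x'_inj) _.
by rewrite ler_pM2l // ler_sum // => i _; apply: cx'.
Qed.

(** Run along x itself when the tag is off this path, along x' otherwise. *)
Lemma swap_energy_line n x x' b : (0 < n)%N -> ladder n x x' -> ladder_cost n x x' b ->
  swap_energy (x 0) (x n) <= 6 * \sum_(i < n.+1) b i.
Proof.
move=> n0 lad cost; pose on := [pred z | [exists i : 'I_n.+1, z == x i]].
have onx i : (i <= n)%N -> on (x i).
  by move=> le_in; apply/existsP; exists (Ordinal (le_in : (i < n.+1)%N)).
have b0 i : (i <= n)%N -> 0 <= b i by exact: ladder_cost_ge0 cost.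
rewrite /swap_energy /tag_energy.
apply: le_trans (energy_split _ _ _ _ (fun w => on (tag w)) _) _.
have off : en (predD (fun w => [pred t | (t != x 0) && (t != x n)] (tag w))
                     (fun w => on (tag w))) (tperm (x 0) (x n)) <= 2 * \sum_(i < n) b i.
  apply: (@le_trans _ _ (tag_en (predC on) (tperm (x 0) (x n)))).
    by apply: energy_sub => w /andP[].
  case: lad cost => [x_inj _ _] [cx _ _].
  apply: le_trans (tag_energy_path S_inv f _ x_inj) _.
    by move=> i le_in; apply/negPn; apply: onx.
  by rewrite ler_pM2l // ler_sum // => i _; apply: cx.
have on_ : en (predI (fun w => [pred t | (t != x 0) && (t != x n)] (tag w))
                     (fun w => on (tag w))) (tperm (x 0) (x n))
     <= 2 * b 0 + 2 * b n + 2 * \sum_(i < n) b i.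
  pose p := [pred t | (t != x 0) && (t != x n) && on t].
  apply: (tag_energy_ladder (p := p) n0 lad cost); rewrite /= ?eqxx ?andbF //.
  move=> i le_in; apply/negP => /andP[_ /existsP[j /eqP]].
  by case: lad => _ _ /(_ j i) xx' x'x; move: xx'; rewrite x'x eqxx -ltnS ltn_ord => /(_ isT le_in).
apply: le_trans (lerD on_ off) _.
rewrite big_ord_recr /=.
have B0 : b 0 <= \sum_(i < n) b i.
  rewrite (bigD1 (Ordinal n0)) //= lerDl sumr_ge0 // => i _.
  by apply: b0; apply: ltnW.
have := b0 _ (leqnn n).
by move: (b 0) (b n) (\sum_(i < n) _) B0 => u v B; lra.
Qed.

(** The cyclic shift that sends the tag from x 0 to the hole at x n.+1, as it is
performed by the pair tag-hole (a product of permutations is read from left to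
right): the hole comes one site closer, the shorter shift leaves the tag at
x m.+1 and the hole at x m behind it, the hole goes around the tag to x m.+2,
and the tag steps into it. *)
Fixpoint rot_word x n : {perm T} :=
  if n is m.+1 then
    (tperm (x m.+1) (x m.+2) * rot_word x m * tperm (x m) (x m.+2) * tperm (x m.+1) (x m.+2))%g
  else tperm (x 0) (x 1).

(** The reverse cyclic shift, on one site less: the hole left behind the tag
walks back to x 0. *)
Fixpoint back_word x n : {perm T} :=
  if n is m.+1 then (tperm (x m) (x m.+1) * back_word x m)%g else 1%g.

Lemma back_word_id x n z : (forall i, (i <= n)%N -> z != x i) -> back_word x n z = z.
Proof.
elim: n => [|n IH] zx /=; first by rewrite perm1.
rewrite permM tpermD 1?eq_sym ?zx //.
by apply: IH => i le_in; apply: zx; apply: leqW.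
Qed.

Section Words.
Variables (n : nat) (x : nat -> T).
Hypothesis x_inj : forall i j, (i <= n.+1)%N -> (j <= n.+1)%N -> x i = x j -> i = j.

Lemma x_neq i j : (i <= n.+1)%N -> (j <= n.+1)%N -> i != j -> x i != x j.
Proof. by move=> le_in le_jn; apply: contraNneq => /x_inj->. Qed.

(** The next two lemmas follow the tag and the hole: the tag ends where the hole
was, and the hole just behind it. *)
Lemma rot_word0 k : (k <= n)%N -> rot_word x k (x 0) = x k.+1.
Proof.
elim: k => [|k IH] le_kn /=; first by rewrite tpermL.
rewrite !permM [X in rot_word _ _ X]tpermD; try (apply: x_neq; lia).
rewrite IH ?(ltnW le_kn) // [X in tperm _ _ X]tpermD ?tpermL //; apply: x_neq; lia.
Qed.

Lemma rot_word1 k : (k <= n)%N -> rot_word x k (x k.+1) = x k.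
Proof.
elim: k => [|k IH] le_kn /=; first by rewrite tpermR.
by rewrite !permM tpermR IH 1?ltnW // tpermL tpermR.
Qed.

(** The forward shift by the tag and the backward shift by the hole cancel on all
intermediate sites.  In the inductive step the three moves that follow the
shorter shift reduce to one transposition, which commutes with the rest of the
way back, and the conclusion follows by conjugation. *)
Lemma rot_backE k : (k <= n)%N -> (rot_word x k * back_word x k)%g = tperm (x 0) (x k.+1).
Proof.
elim: k => [|k IH] le_kn /=; first by rewrite mulg1.
have neq i j : (i <= k.+2)%N -> (j <= k.+2)%N -> i != j -> x i != x j.
  by move=> ? ?; apply: x_neq; lia.
have three : (tperm (x k) (x k.+2) * tperm (x k.+1) (x k.+2) * tperm (x k) (x k.+1))%g
   = tperm (x k.+1) (x k.+2).
  have -> : (tperm (x k) (x k.+2) * tperm (x k.+1) (x k.+2)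
      = tperm (x k) (x k.+1) * tperm (x k) (x k.+2))%g.
    rewrite [RHS]conjgC tpermJ tpermL [tperm _ _ (x k.+1)]tpermD ?neq //; try lia.
    by rewrite [tperm (x k.+2) _]tpermC.
  rewrite -{1}[tperm (x k) (x k.+1)]tpermV -mulgA -[LHS]/(tperm _ _ ^ tperm _ _)%g tpermJ.
  by rewrite tpermL [tperm _ _ (x k.+2)]tpermD ?neq //; lia.
have comm : (tperm (x k.+1) (x k.+2) * back_word x k = back_word x k * tperm (x k.+1) (x k.+2))%g.
  by rewrite conjgC tpermJ !back_word_id // => i le_ik; apply: neq; lia.
rewrite -!mulgA [X in (_ * (_ * X))%g]mulgA [X in (_ * (_ * X))%g]mulgA -[X in (_ * (_ * (X * _)))%g]mulgA.
rewrite [X in (_ * (_ * (X * _)))%g]mulgA three comm [X in (_ * X)%g]mulgA IH; last by lia.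
rewrite -{1}[tperm (x k.+1) (x k.+2)]tpermV -[LHS]/(tperm _ _ ^ tperm _ _)%g tpermJ tpermL.
by rewrite tpermD ?neq //; lia.
Qed.

Lemma hole_at_rot k w : (k <= n)%N -> hole_at (x 0) (x k.+1) w ->
  hole_at (x k.+1) (x k) (to w (rot_word x k)).
Proof.
move=> le_kn /andP[/eqP tag_w hole_w].
by rewrite /hole_at tag_move tag_w rot_word0 // eqxx -(rot_word1 le_kn) occ_move.
Qed.

End Words.

(** The tag occupies its own site, so a swap of the tag with a hole has rate 1. *)
Lemma jump_energy_edge y z : y != z -> jump_energy y z <= edge_en y z.
Proof.
move=> yz; apply: energy_edge => w /andP[/eqP <- hole_w].
by rewrite occ_tag (negPf hole_w) orbT.
Qed.

Lemma back_word_energy n x k p : (forall i, (i <= n)%N -> ~~ p (x i)) -> (k <= n)%N ->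
  tag_en p (back_word x k) <= \sum_(i < k) edge_en (x i) (x i.+1).
Proof.
move=> px; elim: k => [|k IH] le_kn /=; first by rewrite /tag_energy energy1 big_ord0.
have [pk pk1] : ~~ p (x k) /\ ~~ p (x k.+1) by split; apply: px; lia.
apply: le_trans (tag_energy_mul S_inv f _ (tperm_off pk pk1)) _.
by rewrite big_ord_recr [leRHS]addrC /=; apply: lerD; [exact: tag_energy_edge|exact: IH (ltnW le_kn)].
Qed.

(** Only the hop of the hole around the tag leaves the line.  The ladder near a
given site is used in at most three consecutive steps, and the coefficients 2,
6 and 10 record how many of them are done. *)
Lemma rot_word_energy n x x' b k : ladder n.+1 x x' -> ladder_cost n.+1 x x' b -> (k <= n)%N ->
  en (hole_at (x 0) (x k.+1)) (rot_word x k)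
   <= 10 * (\sum_(i < k) b i) + 6 * b k + 2 * b k.+1.
Proof.
move=> lad cost; elim: k => [|k IH] le_kn.
  rewrite big_ord0 mulr0 add0r /=; case: (lad) (cost) => [x_inj _ _] [cx _ _].
  apply: (@le_trans _ _ (b 0)).
    apply: le_trans (jump_energy_edge _) (cx _ _) => //.
    by apply/eqP => /x_inj -/(_ isT isT).
  have := ladder_cost_ge0 cost (leq0n _); have := ladder_cost_ge0 cost (ltn0Sn _).
  by move: (b 0) (b 1) => u v; lra.
have {}IH := IH (ltnW le_kn).
have [x_inj _ xx'] := lad; have [cx cx' cxx'] := cost.
have neq i j : (i <= k.+2)%N -> (j <= k.+2)%N -> i != j -> x i != x j.
  by move=> ? ? ?; apply: (x_neq x_inj); lia.
rewrite /= -!mulgA.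
(* the hole steps from x k.+2 to x k.+1 *)
apply: le_trans (energy_mul S_inv f (Q := hole_at (x 0) (x k.+1)) _ _) _.
  move=> w /andP[/eqP tag_w hole_w]; rewrite /hole_at tag_move tag_w.
  by rewrite tpermD ?neq // eqxx /= occ_moveV tpermV tpermL.
have e1 : en (hole_at (x 0) (x k.+2)) (tperm (x k.+1) (x k.+2)) <= b k.+1.
  apply: le_trans (cx _ _); last by lia.
  by apply: energy_edge => // w /andP[/eqP-> _]; rewrite !neq.
apply: le_trans (lerD e1 (le_refl _)) _.
apply: le_trans (lerD (le_refl _) (energy_mul S_inv f (Q := hole_at (x k.+1) (x k)) _ _)) _.
  by move=> w; apply: (hole_at_rot x_inj); lia.
apply: le_trans (lerD (le_refl _) (lerD IH (energy_mul S_inv f (Q := hole_at (x k.+1) (x k.+2)) _ _))) _.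
  move=> w /andP[/eqP tag_w hole_w]; rewrite /hole_at tag_move tag_w.
  by rewrite tpermD ?neq ?eqxx ?occ_moveV ?tpermV ?tpermR //; lia.
have e3 : en (hole_at (x k.+1) (x k.+2)) (tperm (x k.+1) (x k.+2)) <= b k.+1.
  by apply: le_trans (jump_energy_edge _) (cx _ _); rewrite ?neq //; lia.
have e2 : en (hole_at (x k.+1) (x k)) (tperm (x k) (x k.+2))
   <= 2 * b k + 2 * b k.+2 + 2 * (b k + b k.+1).
  have lad2 : ladder (k + 2) x x' by apply: ladder_le lad; lia.
  have cost2 : ladder_cost (k + 2) x x' b by apply: ladder_cost_le cost; lia.
  have := tag_energy_ladder (p := pred1 (x k.+1)) (isT : (0 < 2)%N) (ladder_shift lad2) (ladder_cost_shift cost2).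
  rewrite !big_ord_recr big_ord0 /= add0r addn0 addn1 addn2 => H.
  apply: (@le_trans _ _ (tag_en (pred1 (x k.+1)) (tperm (x k) (x k.+2)))).
    by apply: energy_sub => w /andP[].
  apply: H; rewrite ?neq //; try lia.
  by move=> i le_i2; rewrite eq_sym xx' //; lia.
rewrite big_ord_recr /=; move: e2 e3.
set X := en _ _; set Y := en _ _.
by move: (\sum_(i < k) _) (b k) (b k.+1) (b k.+2) X Y => s u v z X Y; lra.
Qed.

Lemma jump_energy_line n x x' b : ladder n.+1 x x' -> ladder_cost n.+1 x x' b ->
  jump_energy (x 0) (x n.+1) <= 11 * \sum_(i < n.+2) b i.
Proof.
move=> lad cost; have [x_inj _ _] := lad; have [cx _ _] := cost.
rewrite /jump_energy -(rot_backE x_inj (leqnn n)).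
apply: le_trans (energy_mul S_inv f (Q := hole_at (x n.+1) (x n)) _ _) _.
  by move=> w; apply: (hole_at_rot x_inj).
have E1 := rot_word_energy lad cost (leqnn n).
have E2 : en (hole_at (x n.+1) (x n)) (back_word x n) <= \sum_(i < n) b i.
  apply: (@le_trans _ _ (tag_en (pred1 (x n.+1)) (back_word x n))).
    by apply: energy_sub => w /andP[].
  apply: le_trans (back_word_energy (n := n) _ _) _ => //.
    by move=> i le_in; apply: (x_neq x_inj); lia.
  by apply: ler_sum => i _; apply: cx; apply: ltnW; rewrite ltnS.
apply: le_trans (lerD E1 E2) _.
rewrite !big_ord_recr /=.
have := ladder_cost_ge0 cost (leqnSn n); have := ladder_cost_ge0 cost (leqnn n.+1).
by move: (\sum_(i < n) _) (b n) (b n.+1) => s u v; lra.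
Qed.

End Ladder.

(** * Factoring long moves through intermediate sites *)

Section Via.
Variables (R : rcfType) (T : finType).
Local Notation to := (move_action T).
Variable S : {set tagged T}.
Hypothesis S_inv : forall w s, (to w s \in S) = (w \in S).
Variable f : tagged T -> R.
Implicit Types (x y z : T).
Local Notation swap_en := (swap_energy S f).
Local Notation jump_en := (jump_energy S f).

Lemma swap_energy_ge0 x y : 0 <= swap_en x y. Proof. exact: energy_ge0. Qed.
Lemma jump_energy_ge0 x y : 0 <= jump_en x y. Proof. exact: energy_ge0. Qed.

(** Go through z, or through z' when the tag sits at z. *)
Lemma swap_energy_via x y z z' : uniq [:: x; y; z; z'] ->
  swap_en x y <= 2 * swap_en x z + swap_en z y + (2 * swap_en x z' + swap_en z' y).
Proof.
rewrite /= !inE !negb_or andbT => /and3P[/and3P[xy xz xz'] /andP[yz yz'] zz'].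
have via u (p : pred T) : u != x -> u != y -> (forall t, p t -> (t != x) && (t != y) && (t != u)) ->
    tag_energy S f p (tperm x y) <= 2 * swap_en x u + swap_en u y.
  move=> ux uy pP; have p' v : v \in [:: x; y; u] -> ~~ p v.
    move=> vin; apply/negP => /pP; move: vin; rewrite !inE.
    by case/or3P => /eqP->; rewrite eqxx ?andbF.
  apply: le_trans (tag_energy_conj S_inv f (y := u) _ _ _ xy uy) _.
  - by apply: p'; rewrite !inE eqxx.
  - by apply: p'; rewrite !inE eqxx ?orbT.
  - by apply: p'; rewrite !inE eqxx ?orbT.
  by rewrite lerD ?ler_pM2l //; apply: energy_sub => w /pP /andP[/andP[h1 h2] h3] /=; rewrite ?h1 ?h2 ?h3.
rewrite {1}/swap_energy /tag_energy.
apply: le_trans (energy_split _ _ _ _ (fun w => tag w == z) _) _; rewrite addrC lerD //.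
  apply: (le_trans _ (via z [pred t | (t != x) && (t != y) && (t != z)] _ _ _)) => //.
  - by apply: energy_sub => w /=; rewrite andbC.
  - by rewrite eq_sym.
  - by rewrite eq_sym.
apply: (le_trans _ (via z' [pred t | (t != x) && (t != y) && (t == z)] _ _ _)) => //.
- by rewrite eq_sym.
- by rewrite eq_sym.
- by move=> t /= /andP[-> /eqP->].
Qed.

(** With tag, content c and hole at x, z, y, the hole is exchanged with c and the
tag jumps to z; then the hole left at x is exchanged with c, the tag jumps on to
y, and a last exchange puts c back at z. *)
Lemma jump_energy_via x y z : uniq [:: x; y; z] ->
  jump_en x y <= swap_en z y + jump_en x z + swap_en x y + jump_en z y + swap_en x z.
Proof.
rewrite /= !inE !negb_or andbT => /andP[/andP[xy xz] yz].
rewrite {1}/jump_energy.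
have -> : tperm x y = (tperm z y * (tperm x z * (tperm x y * (tperm z y * tperm x z))))%g.
  have ab : (tperm z y * tperm x z = tperm x y * tperm z y)%g.
    rewrite [RHS]conjgC tpermJ tpermR [tperm _ _ x]tpermD //; first by rewrite eq_sym.
    by rewrite eq_sym.
  by rewrite ab [(tperm x y * (tperm x y * _))%g]mulgA tperm2 mul1g mulgA ab -mulgA tperm2 mulg1.
have [yx zx zy] : [/\ y != x, z != x & z != y] by rewrite ![_ == x]eq_sym [z == y]eq_sym.
have swap (P : pred (tagged T)) u v : (forall w, P w -> (tag w != u) && (tag w != v)) ->
    energy to S f P (tperm u v) <= swap_en u v.
  by move=> Puv; apply: energy_sub => w /Puv.
rewrite -!addrA.
apply: le_trans (energy_mul S_inv f (Q := hole_at x z) _ _) (lerD (swap _ _ _ _) _).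
- move=> w /andP[/eqP tw hw].
  by rewrite /hole_at tag_move tw tpermD // eqxx occ_moveV tpermV tpermL.
- by move=> w /andP[/eqP-> _]; rewrite xz.
apply: le_trans (energy_mul S_inv f (Q := hole_at z x) _ _) (lerD (lexx _) _).
  move=> w /andP[/eqP tw hw].
  by rewrite /hole_at tag_move tw tpermL eqxx occ_moveV tpermV tpermL.
apply: le_trans (energy_mul S_inv f (Q := hole_at z y) _ _) (lerD (swap _ _ _ _) _).
- move=> w /andP[/eqP tw hw].
  by rewrite /hole_at tag_move tw tpermD // eqxx occ_moveV tpermV tpermR.
- by move=> w /andP[/eqP-> _]; rewrite zx.
apply: le_trans (energy_mul S_inv f (Q := fun w => tag w == y) _ _) (lerD (lexx _) (swap _ _ _ _)).
- by move=> w /andP[/eqP tw hw]; rewrite tag_move tw tpermL.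
- by move=> w /eqP->; rewrite yx.
Qed.

End Via.

(** * Changing coordinates one at a time *)

Section Mix.
Variables (d : nat) (C : finType).
Local Notation T := {ffun 'I_d -> C}.
Implicit Types (x y z : T) (A B : {set 'I_d}) (k : 'I_d).

Definition mix A x y : T := [ffun j => if j \in A then y j else x j].

Lemma mixK A x y : mix A (mix A x y) (mix A y x) = x.
Proof. by apply/ffunP => j; rewrite !ffunE; case: (j \in A). Qed.

(** If two corners of the rectangle spanned by x and y in the directions A and B
coincide, the rectangle is flat and the corner opposite to x is one of its two
neighbours. *)
Lemma mix_degenerate A B x y : [disjoint A & B] ->
  [/\ mix A x y = x -> mix (A :|: B) x y = mix B x y,
      mix B x y = x -> mix (A :|: B) x y = mix A x y,
      mix (A :|: B) x y = x -> mix (A :|: B) x y = mix A x y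
    & mix A x y = mix B x y -> mix (A :|: B) x y = mix B x y].
Proof.
move=> dAB; split=> /ffunP H; apply/ffunP => j; have := H j; rewrite !ffunE inE;
  by case: (boolP (j \in A)) => [jA|_]; rewrite ?(disjointFr dAB jA) //=; case: (j \in B).
Qed.

Lemma mixT x y : mix setT x y = y.
Proof. by apply/ffunP => j; rewrite !ffunE inE. Qed.

Lemma mix0 x y : mix set0 x y = x.
Proof. by apply/ffunP => j; rewrite !ffunE inE. Qed.

Lemma mixU A B x y : [disjoint A & B] -> mix (A :|: B) x y = mix B (mix A x y) (mix A y x).
Proof.
move=> dAB; apply/ffunP => j; rewrite !ffunE inE orbC.
by case: (boolP (j \in B)) => //= jB; rewrite (disjointFl dAB jB).
Qed.

(** Exchanging the coordinates in A between x and y is an involution on pairs: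
intermediate points of uniform pairs are uniform. *)
Lemma sum_mix (R : nmodType) A (G : T -> T -> R) :
  \sum_x \sum_y G (mix A x y) (mix A y x) = \sum_x \sum_y G x y.
Proof.
rewrite !pair_big /= [RHS](reindex_inj (h := fun p => (mix A p.1 p.2, mix A p.2 p.1))) //.
by apply: (can_inj (g := fun p => (mix A p.1 p.2, mix A p.2 p.1))) => -[x y] /=; rewrite !mixK.
Qed.

Definition upd x k a : T := [ffun j => if j == k then a else x j].

Lemma upd_k x k a : upd x k a k = a.
Proof. by rewrite ffunE eqxx. Qed.

Lemma upd_neq x k j a : j != k -> upd x k a j = x j.
Proof. by rewrite ffunE => /negPf->. Qed.

Lemma mix1 k x y : mix [set k] x y = upd x k (y k).
Proof. by apply/ffunP => j; rewrite !ffunE inE; case: eqP => // ->. Qed.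

Lemma sum_upd (R : nmodType) k (G : T -> R) :
  \sum_x \sum_a G (upd x k a) = (\sum_x G x) *+ #|C|.
Proof.
transitivity (\sum_(p : T * C) G p.1); last first.
  rewrite -(pair_big xpredT xpredT (fun x (_ : C) => G x)) /= -sumrMnl.
  by apply: eq_bigr => x _; rewrite sumr_const.
rewrite pair_big /= [RHS](reindex_inj (h := fun p => (upd p.1 k p.2, p.1 k))) //.
apply: (can_inj (g := fun p => (upd p.1 k p.2, p.1 k))) => -[x a] /=.
congr pair; last by rewrite upd_k.
by apply/ffunP => j; rewrite !ffunE; case: eqP => // ->.
Qed.

End Mix.

Section MixEnergy.
Variables (R : rcfType) (d : nat) (C : finType).
Local Notation T := ({ffun 'I_d -> C} : finType).
Local Notation to := (move_action T).
Variable S : {set tagged T}.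
Hypothesis S_inv : forall w s, (to w s \in S) = (w \in S).
Variable f : tagged T -> R.
Implicit Types (x y z : T) (A B : {set 'I_d}).
Local Notation swap_en := (swap_energy S f).
Local Notation jump_en := (jump_energy S f).

Section Telescope.
Variable V : R.
Hypothesis V_swap : forall k, \sum_x \sum_y swap_en x (mix [set k] x y) ^+ 2 <= V.
Hypothesis V_jump : forall k, \sum_x \sum_y jump_en x (mix [set k] x y) ^+ 2 <= V.

(** All pairs that differ in the directions A only, each counted with the
multiplicity that makes the pairs x, y uniform. *)
Definition swap_sum A := \sum_x \sum_y swap_en x (mix A x y) ^+ 2.
Definition jump_sum A := \sum_x \sum_y jump_en x (mix A x y) ^+ 2.

(** Swap through the two remaining corners of the rectangle; a path through a
single corner could be blocked by the tag. *)
Lemma swap_sumU A B : [disjoint A & B] ->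
  swap_sum (A :|: B) <= 20 * (swap_sum A + swap_sum B).
Proof.
move=> dAB; have dBA : [disjoint B & A] by rewrite disjoint_sym.
have EA : swap_sum A = \sum_x \sum_y swap_en (mix B x y) (mix (A :|: B) x y) ^+ 2.
  rewrite /swap_sum -(sum_mix B); apply: eq_bigr => x _; apply: eq_bigr => y _.
  by rewrite setUC mixU.
have EB : swap_sum B = \sum_x \sum_y swap_en (mix A x y) (mix (A :|: B) x y) ^+ 2.
  rewrite /swap_sum -(sum_mix A); apply: eq_bigr => x _; apply: eq_bigr => y _.
  by rewrite mixU.
have -> : 20 * (swap_sum A + swap_sum B)
    = 10 * (swap_sum A + swap_sum B + swap_sum B + swap_sum A) by ring.
rewrite {2}EA {1}EB /swap_sum -!big_split mulr_sumr; apply: ler_sum => x _ /=.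
rewrite -!big_split mulr_sumr; apply: ler_sum => y _ /=.
set z := mix A x y; set z' := mix B x y; set q := mix (A :|: B) x y.
have [a0 b0 c0 d0] := And4 (swap_energy_ge0 S f x z) (swap_energy_ge0 S f z q)
  (swap_energy_ge0 S f x z') (swap_energy_ge0 S f z' q).
suff : swap_en x q <= 2 * swap_en x z + swap_en z q + (2 * swap_en x z' + swap_en z' q).
  have := swap_energy_ge0 S f x q.
  move: (swap_en x q) (swap_en x z) (swap_en z q) (swap_en x z') (swap_en z' q) a0 b0 c0 d0.
  move=> u a b c e a0 b0 c0 e0 u0 H.
  apply: (@le_trans _ _ ((2 * a + b + (2 * c + e)) ^+ 2)).
    by rewrite ler_pXn2r // nnegrE ?addr_ge0 ?mulr_ge0.
  (* the squares that make up the Cauchy-Schwarz defect for weights 2, 1, 2, 1 *)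
  have := sqr_ge0 (a - 2 * b); have := sqr_ge0 (c - 2 * e); have := sqr_ge0 (a - c).
  have := sqr_ge0 (b - e); have := sqr_ge0 (a - 2 * e); have := sqr_ge0 (c - 2 * b).
  by nra.
have [qB|qB] := eqVneq q z'.
  by rewrite -qB in c0 d0 *; move: a0 b0 c0 d0; lra.
have [qA|qA] := eqVneq q z.
  by rewrite -qA in a0 b0 *; move: a0 b0 c0 d0; lra.
have [xz xz' xq zz'] := mix_degenerate x y dAB.
have ne (a b c : T) : (a = b -> q = c) -> q != c -> a != b by move=> H; apply: contraNneq => /H->.
apply: (swap_energy_via S_inv); rewrite /= !inE !negb_or qA qB.
by rewrite ![x == _]eq_sym (ne _ _ _ xq) // (ne _ _ _ xz) // (ne _ _ _ xz') // (ne _ _ _ zz').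
Qed.

Lemma jump_sumU A B : [disjoint A & B] ->
  jump_sum (A :|: B) <=
  5 * (swap_sum B + jump_sum A + swap_sum (A :|: B) + jump_sum B + swap_sum A).
Proof.
move=> dAB.
have E (G : T -> T -> R) : \sum_x \sum_y G x (mix B x y)
    = \sum_x \sum_y G (mix A x y) (mix (A :|: B) x y).
  rewrite -(sum_mix A); apply: eq_bigr => x _; apply: eq_bigr => y _.
  by rewrite mixU.
rewrite /swap_sum /jump_sum (E (fun x y => swap_en x y ^+ 2)) (E (fun x y => jump_en x y ^+ 2)).
rewrite -!big_split mulr_sumr; apply: ler_sum => x _ /=.
rewrite -!big_split mulr_sumr; apply: ler_sum => y _ /=.
set z := mix A x y; set q := mix (A :|: B) x y.
have [a0 b0 c0 d0] := And4 (swap_energy_ge0 S f z q) (jump_energy_ge0 S f x z)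
  (swap_energy_ge0 S f x q) (jump_energy_ge0 S f z q).
have e0 := swap_energy_ge0 S f x z.
suff : jump_en x q <= swap_en z q + jump_en x z + swap_en x q + jump_en z q + swap_en x z.
  have := jump_energy_ge0 S f x q.
  move: (jump_en x q) (swap_en z q) (jump_en x z) (swap_en x q) (jump_en z q) (swap_en x z) a0 b0 c0 d0 e0.
  move=> u a b c e g a0 b0 c0 e0 g0 u0 H.
  apply: (@le_trans _ _ ((a + b + c + e + g) ^+ 2)).
    by rewrite ler_pXn2r // nnegrE ?addr_ge0.
  rewrite -subr_ge0 (_ : _ - _ = (a - b) ^+ 2 + (a - c) ^+ 2 + (a - e) ^+ 2 + (a - g) ^+ 2
    + (b - c) ^+ 2 + (b - e) ^+ 2 + (b - g) ^+ 2 + (c - e) ^+ 2 + (c - g) ^+ 2 + (e - g) ^+ 2).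
    by rewrite !addr_ge0 ?sqr_ge0.
  by ring.
have [qz|qz] := eqVneq q z; first by rewrite -qz in a0 b0 d0 e0 *; move: a0 b0 c0 d0 e0; lra.
have [xz|xz] := eqVneq x z; first by rewrite -xz in a0 b0 d0 e0 *; move: a0 b0 c0 d0 e0; lra.
have [_ _ xq _] := mix_degenerate x y dAB.
apply: (jump_energy_via S_inv); rewrite /= !inE !negb_or xz qz eq_sym !andbT.
by apply: contraNneq qz => H; apply/eqP/xq/esym.
Qed.

Lemma swap_sum0 : swap_sum set0 = 0.
Proof.
apply: big1 => x _; apply: big1 => y _.
by rewrite mix0 /swap_energy tperm1 /tag_energy energy1 expr0n.
Qed.

Lemma jump_sum0 : jump_sum set0 = 0.
Proof.
apply: big1 => x _; apply: big1 => y _.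
by rewrite mix0 /jump_energy tperm1 energy1 expr0n.
Qed.

Hypothesis V0 : 0 <= V.

(** Each further direction multiplies the bound by at most a constant; 40 leaves
room for both recursions. *)
Lemma mix_sum_le A : swap_sum A <= 40 ^+ #|A| * V /\ jump_sum A <= 20 * (40 ^+ #|A| * V).
Proof.
move: {2}#|A| (erefl #|A|) => n.
elim: n A => [|n IH] A cA.
  rewrite (cards0_eq cA) swap_sum0 jump_sum0 cards0.
  by rewrite expr0 mul1r V0 mulr_ge0.
have [k kA] : exists k, k \in A by apply/card_gt0P; rewrite cA.
have cB : #|A :\ k| = n by move: cA; rewrite (cardsD1 k A) kA => -[].
have [IHs IHj] := IH _ cB; rewrite cB in IHs IHj.
have dBk : [disjoint A :\ k & [set k]] by rewrite disjoint_sym disjoints1 !inE eqxx.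
have -> : A = (A :\ k) :|: [set k] by rewrite setUC setD1K.
have := swap_sumU dBk; have := jump_sumU dBk.
rewrite setUC setD1K // cA.
have := V_swap k; have := V_jump k; rewrite -/(swap_sum _) -/(jump_sum _).
have : 1 <= 40 ^+ n :> R by rewrite exprn_ege1 // ler1n.
move=> e1 vj vs HJ HS; rewrite exprS.
have eV : V <= 40 ^+ n * V by rewrite ler_peMl.
rewrite -mulrA; move: (40 ^+ n * V) eV IHs IHj HJ HS vj vs.
move: (swap_sum A) (jump_sum A) (swap_sum (A :\ k)) (jump_sum (A :\ k)) (swap_sum _) (jump_sum _) V0.
move=> a b u v s t V00 X *.
by split; lra.
Qed.

End Telescope.
End MixEnergy.

(** * Lines of the box *)

Lemma sqr_sum_le (R : realDomainType) (I : finType) (b : I -> R) :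
  (\sum_i b i) ^+ 2 <= #|I|%:R * \sum_i b i ^+ 2.
Proof.
have : 0 <= \sum_i \sum_j (b i - b j) ^+ 2.
  by apply: sumr_ge0 => i _; apply: sumr_ge0 => j _; apply: sqr_ge0.
have -> : \sum_i \sum_j (b i - b j) ^+ 2 = (#|I|%:R * (\sum_i b i ^+ 2) - (\sum_i b i) ^+ 2) *+ 2.
  transitivity (\sum_i \sum_j (b i ^+ 2 + b j ^+ 2 - (b i * b j) *+ 2)).
    by apply: eq_bigr => i _; apply: eq_bigr => j _; ring.
  under eq_bigr do rewrite sumrB big_split /= sumr_const sumrMnl.
  rewrite sumrB big_split /= sumr_const !sumrMnl -big_distrlr /=.
  rewrite -[_ *+ #|_|]mulr_natl expr2; move: (\sum_i b i ^+ 2) (\sum_i b i) (#|I|%:R : R) => X Y N.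
  by ring.
by rewrite pmulrn_lge0 // subr_ge0.
Qed.

Lemma sum_window (R : numDomainType) (b : nat -> R) a n L : (a + n <= L)%N ->
  (forall i, (i < L)%N -> 0 <= b i) ->
  \sum_(i < n) b (a + i)%N <= \sum_(i < L) b i.
Proof.
move=> anL b0; rewrite -[leRHS](big_mkord xpredT b).
rewrite (@big_cat_nat _ _ _ a) //=; last by lia.
rewrite (@big_cat_nat _ _ _ (a + n) a) //=; last by lia.
rewrite -[X in X <= _]add0r lerD //.
  by rewrite big_nat sumr_ge0 // => i /andP[_ ia]; apply: b0; lia.
have -> : \sum_(a <= i < a + n) b i = \sum_(i < n) b (a + i)%N.
  rewrite -{1}[a]add0n big_addn addKn big_mkord.
  by apply: eq_bigr => i _; rewrite addnC.
by rewrite lerDl big_nat sumr_ge0 // => i /andP[_ ia]; apply: b0.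
Qed.

Section Box.
Variables (R : realType) (d l : nat).
Hypotheses (d2 : (2 <= d)%N) (l1 : (1 <= l)%N).
Local Notation L := (l.*2.+1).
Local Notation T := (box d l).
Local Notation to := (move_action T).
Variable S : {set tagged T}.
Hypothesis S_inv : forall w s, (to w s \in S) = (w \in S).
Variable f : tagged T -> R.
Implicit Types (x y z : T).
Local Notation swap_en := (swap_energy S f).
Local Notation jump_en := (jump_energy S f).
Local Notation edge_en := (edge_energy S f).

Definition site_energy z : R := \sum_(z' | eucl_dist R z z' == 1) edge_en z z' ^+ 2.

Lemma site_energy_ge0 z : 0 <= site_energy z.
Proof. by apply: sumr_ge0 => z' _; apply: sqr_ge0. Qed.

Lemma edge_energy_site z z' : eucl_dist R z z' == 1 -> edge_en z z' ^+ 2 <= site_energy z.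
Proof.
by move=> zz'; rewrite /site_energy (bigD1 z') //= lerDl sumr_ge0 // => y _; apply: sqr_ge0.
Qed.

Lemma dist_upd x k (a b : 'I_L) : (a.+1 == b :> nat) || (b.+1 == a :> nat) ->
  eucl_dist R (upd x k a : T) (upd x k b : T) == 1.
Proof.
move=> ab; rewrite /eucl_dist (bigD1 k) //= big1 ?addr0 => [|j jk].
  rewrite /box_coord !upd_k.
  have [->|->] : ((a : nat)%:Z - l%:Z - ((b : nat)%:Z - l%:Z) = 1)
      \/ ((a : nat)%:Z - l%:Z - ((b : nat)%:Z - l%:Z) = -1).
    by case/orP: ab => /eqP; lia.
  - by rewrite expr1n sqrtr1.
  by rewrite rmorphN1 sqrrN expr1n sqrtr1.
by rewrite /box_coord !upd_neq // subrr expr0n.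
Qed.

Lemma upd_id x k : upd x k (x k) = x.
Proof. by apply/ffunP => j; rewrite ffunE; case: eqP => // ->. Qed.

Lemma upd_upd x k a b : upd (upd x k a) k b = upd x k b.
Proof. by apply/ffunP => j; rewrite !ffunE; case: eqP. Qed.

Lemma updC x k k' a b : k != k' -> upd (upd x k a) k' b = upd (upd x k' b) k a.
Proof.
move=> kk'; apply/ffunP => j; rewrite !ffunE.
by case: (eqVneq j k') => [->|//]; rewrite eq_sym (negPf kk').
Qed.

(** A neighbour that stays inside the box: one step up, except at the upper
end.  As a step up or down modulo the length it is at most two-to-one. *)
Definition turn (a : 'I_L) : 'I_L := if (a < l.*2)%N then ordS a else ord_pred a.

Lemma turn_adj (a : 'I_L) : (a.+1 == turn a :> nat) || ((turn a).+1 == a :> nat).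
Proof.
rewrite /turn; case: ltnP => al /=.
  by rewrite modn_small ?eqxx //; lia.
have -> : a = l.*2 :> nat by have := ltn_ord a; lia.
have -> : (l.*2 + L).-1 = (l.*2.-1 + L)%N by lia.
by rewrite modnDr modn_small; lia.
Qed.

Lemma turn_neq a : turn a != a.
Proof. by apply/eqP => eq_a; have := turn_adj a; rewrite eq_a; lia. Qed.

(** The neighbour of x on the parallel line, in direction k. *)
Definition rung k x : T := upd x k (turn (x k)).

Lemma dist_rung k x : eucl_dist R x (rung k x) == 1.
Proof. by rewrite -{1}[x](upd_id x k); apply: dist_upd; apply: turn_adj. Qed.

(** Local energy at x and at the other end of its rung: it controls all edges of
the ladder at x. *)
Definition ladder_energy k x : R := site_energy x + site_energy (rung k x).

Lemma ladder_energy_ge0 k x : 0 <= ladder_energy k x.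
Proof. by rewrite addr_ge0 ?site_energy_ge0. Qed.

(** Bound the turn by the sum of the two cyclic shifts, which are bijections. *)
Lemma sum_ladder_energy k : \sum_x ladder_energy k x <= 3 * \sum_x site_energy x.
Proof.
have shift (g h : 'I_L -> 'I_L) : cancel g h ->
    \sum_x site_energy (upd x k (g (x k)) : T) = \sum_x site_energy x.
  move=> gK; rewrite [RHS](reindex_inj (h := fun x => upd x k (g (x k)) : T)) //.
  apply: (can_inj (g := fun x => upd x k (h (x k)) : T)) => x.
  by rewrite upd_k gK upd_upd upd_id.
have -> : 3 * \sum_x site_energy x
    = \sum_x (site_energy x + (site_energy (upd x k (ordS (x k)) : T) + site_energy (upd x k (ord_pred (x k)) : T))).
  rewrite !big_split /= (shift _ _ (@ordSK _)) (shift _ _ (@ord_predK _)).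
  by move: (\sum_x _) => X; ring.
apply: ler_sum => x _; rewrite /ladder_energy lerD2l /rung /turn.
by case: ifP => _; rewrite ?lerDl ?lerDr site_energy_ge0.
Qed.

Section Line.
Variables (k k' : 'I_d) (x : T).
Hypothesis kk' : k != k'.

Let row i : T := upd x k (inord i).
Let row' i : T := upd (rung k' x) k (inord i).

Lemma rung_row i : row' i = rung k' (row i).
Proof.
rewrite /row' /rung /row updC 1?eq_sym // upd_neq //.
by rewrite eq_sym.
Qed.

Lemma row_ladder : ladder l.*2 row row'.
Proof.
have inj (y : T) i j : (i <= l.*2)%N -> (j <= l.*2)%N ->
    upd y k (inord i) = upd y k (inord j) -> i = j.
  move=> il jl /ffunP/(_ k); rewrite !upd_k => /(congr1 val) /=.
  by rewrite !inordK.
split; [exact: inj|exact: inj|move=> i j _ _].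
apply/eqP => /ffunP/(_ k').
rewrite /row /row' /rung upd_neq 1?eq_sym // upd_neq 1?eq_sym // upd_k => /esym/eqP.
by rewrite (negPf (turn_neq _)).
Qed.

Lemma edge_energy_le_sqrt y z e : eucl_dist R y z == 1 -> site_energy y <= e -> edge_en y z <= Num.sqrt e.
Proof.
move=> yz le_e; rewrite -[edge_en y z]ger0_norm ?edge_energy_ge0 // -sqrtr_sqr ler_wsqrtr //.
exact: le_trans (edge_energy_site yz) le_e.
Qed.

Let cost i : R := Num.sqrt (ladder_energy k' (row i)).

Lemma row_cost : ladder_cost S f l.*2 row row' cost.
Proof.
have adj (y : T) i : (i < l.*2)%N -> eucl_dist R (upd y k (inord i) : T) (upd y k (inord i.+1) : T) == 1.
  by move=> il; apply: dist_upd; rewrite !inordK ?eqxx //; lia.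
split=> i il; apply: edge_energy_le_sqrt; rewrite ?adj ?rung_row ?dist_rung //.
- by rewrite lerDl site_energy_ge0.
- by rewrite lerDr site_energy_ge0.
- by rewrite lerDl site_energy_ge0.
Qed.

(** Cauchy-Schwarz along the path costs the length of the line. *)
Lemma row_sum a n c : (a + n <= L)%N -> 0 <= c ->
  (c * \sum_(i < n) cost (a + i)%N) ^+ 2 <= c ^+ 2 * (L%:R * \sum_b ladder_energy k' (upd x k b : T)).
Proof.
move=> anL c0; rewrite exprMn ler_wpM2l ?exprn_ge0 //.
have cost0 i : 0 <= cost i by exact: sqrtr_ge0.
apply: (@le_trans _ _ ((\sum_(i < L) cost i) ^+ 2)).
  rewrite ler_pXn2r ?nnegrE ?sumr_ge0 //.
  exact: sum_window.
apply: le_trans (sqr_sum_le _) _; rewrite card_ord ler_wpM2l //.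
by apply: ler_sum => i _; rewrite sqr_sqrtr ?ladder_energy_ge0 // /row inord_val.
Qed.

End Line.

Lemma line_energy k k' x (a b : 'I_L) : k != k' -> (a < b)%N ->
  swap_en (upd x k a) (upd x k b) ^+ 2
    <= 121 * (L%:R * \sum_c ladder_energy k' (upd x k c : T)) /\
  jump_en (upd x k a) (upd x k b) ^+ 2
    <= 121 * (L%:R * \sum_c ladder_energy k' (upd x k c : T)).
Proof.
move=> kk' ab.
have [n def_b] : exists n, b = (a + n.+1)%N :> nat by exists (b - a).-1; lia.
have anL : (a + n.+1 <= l.*2)%N by rewrite -def_b -ltnS.
have lad := ladder_shift (ladder_le anL (row_ladder x kk')).
have cst := ladder_cost_shift (ladder_cost_le anL (row_cost x kk')).
have sw := swap_energy_line S_inv (ltn0Sn n) lad cst.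
have ju := jump_energy_line S_inv lad cst.
rewrite addn0 -def_b !inord_val in sw ju.
have anL' : (a + n.+2 <= L)%N by rewrite addnS ltnS.
have s0 : 0 <= \sum_c ladder_energy k' (upd x k c : T).
  by apply: sumr_ge0 => c _; apply: ladder_energy_ge0.
split.
  apply: (@le_trans _ _ (6 ^+ 2 * (L%:R * \sum_c ladder_energy k' (upd x k c : T)))); last first.
    by rewrite ler_wpM2r ?mulr_ge0 //; lra.
  apply: le_trans (row_sum _ _ _ anL' _) => //.
  by rewrite ler_pXn2r ?nnegrE ?swap_energy_ge0 // (le_trans _ sw) ?swap_energy_ge0.
rewrite (_ : 121 = 11 ^+ 2 :> R); last by ring.
apply: le_trans (row_sum _ _ _ anL' _) => //.
by rewrite ler_pXn2r ?nnegrE ?jump_energy_ge0 // (le_trans _ ju) ?jump_energy_ge0.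
Qed.

Lemma site_sum_ge0 : 0 <= \sum_x site_energy x.
Proof. by apply: sumr_ge0 => x _; apply: site_energy_ge0. Qed.

(** 363 = 3 * 121, from [sum_ladder_energy] and [line_energy]; one factor L is
the length of a path, the other one counts the lines through which a given site
is seen. *)
Definition line_bound : R := 363 * (#|T|%:R * L%:R ^+ 2 * \sum_x site_energy x).

Lemma line_bound_ge0 : 0 <= line_bound.
Proof. by rewrite !mulr_ge0 ?site_sum_ge0 ?exprn_ge0. Qed.

Lemma line_sum (e : T -> T -> R) k :
    (forall x y, e x y = e y x) -> (forall x, e x x = 0) ->
    (forall k' x (a b : 'I_L), k != k' -> (a < b)%N -> e (upd x k a) (upd x k b)
       <= 121 * (L%:R * \sum_c ladder_energy k' (upd x k c : T))) ->
  \sum_x \sum_y e x (mix [set k] x y) <= line_bound.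
Proof.
move=> eC e0 e_le.
have [k' kk'] : exists k', k != k'.
  have /card_gt0P[k'] : (0 < #|[set~ k]|)%N by rewrite cardsC1 card_ord; lia.
  by rewrite !inE eq_sym; exists k'.
apply: (@le_trans _ _ (\sum_x \sum_(y : T) 121 * (L%:R * \sum_c ladder_energy k' (upd x k c : T)))).
  apply: ler_sum => x _; apply: ler_sum => y _.
  rewrite mix1 -{1}[x](upd_id x k).
  have [xy|yx|xy] := ltngtP (x k) (y k); first exact: e_le.
    by rewrite eC; apply: e_le.
  rewrite (val_inj xy) e0 !mulr_ge0 // sumr_ge0 // => c _; exact: ladder_energy_ge0.
under eq_bigr do rewrite sumr_const.
rewrite sumrMnl -mulr_sumr -mulr_sumr sum_upd card_ord -[_ *+ #|_|]mulr_natl -[_ *+ L]mulr_natl.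
rewrite /line_bound; have := sum_ladder_energy k'.
move: (\sum_x ladder_energy _ _) (\sum_x site_energy _) => u v uv.
rewrite (_ : 363 * _ = #|T|%:R * (121 * (L%:R * (L%:R * (3 * v))))); last by ring.
by rewrite mulr1 -[u *+ L]mulr_natl !ler_wpM2l.
Qed.

Lemma swap_energyC x y : swap_en x y = swap_en y x.
Proof.
rewrite /swap_energy tpermC /tag_energy; congr (Num.sqrt _).
by apply: eq_bigl => w /=; rewrite [(_ != x) && _]andbC.
Qed.

Lemma jump_energyC x y : jump_en x y = jump_en y x.
Proof.
suff le u v : jump_en u v <= jump_en v u by apply/eqP; rewrite eq_le !le.
rewrite /jump_energy [tperm v u]tpermC -{2}(tpermV u v); apply: energy_inv => // w /andP[/eqP tw hw].
by rewrite /hole_at tag_move tw tpermL eqxx occ_moveV tpermV tpermL.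
Qed.

(** The diffusive scaling: up to a constant that depends on d, both sums over the
N^2 pairs are at most N L^2 times the nearest-neighbour energy. *)
Lemma box_energy_sum :
  \sum_x \sum_y swap_en x y ^+ 2 <= 40 ^+ d * line_bound /\
  \sum_x \sum_y jump_en x y ^+ 2 <= 20 * (40 ^+ d * line_bound).
Proof.
have [||swap_le jump_le] := mix_sum_le S_inv (f := f) _ _ line_bound_ge0 setT.
- move=> k; apply: (line_sum (e := fun x y => swap_en x y ^+ 2)) => [x y|x|k' x a b kk' ab].
  + by rewrite swap_energyC.
  + by rewrite /swap_energy tperm1 /tag_energy energy1 expr0n.
  + by case: (line_energy x kk' ab).
- move=> k; apply: (line_sum (e := fun x y => jump_en x y ^+ 2)) => [x y|x|k' x a b kk' ab].
  + by rewrite jump_energyC.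
  + by rewrite /jump_energy tperm1 energy1 expr0n.
  + by case: (line_energy x kk' ab).
have mixTE (G : T -> T -> R) : \sum_x \sum_y G x (mix setT x y) = \sum_x \sum_y G x y.
  by apply: eq_bigr => x _; apply: eq_bigr => y _; rewrite mixT.
move: swap_le jump_le; rewrite cardsT card_ord -(mixTE (fun x y => swap_en x y ^+ 2)).
by rewrite -(mixTE (fun x y => jump_en x y ^+ 2)).
Qed.

End Box.

(** * Swapping the tag with a particle through a hole *)

Section ExchangeEnergy.
Variables (R : rcfType) (T : finType).
Local Notation to := (move_action T).
Variable S : {set tagged T}.
Hypothesis S_inv : forall w s, (to w s \in S) = (w \in S).
Variable f : tagged T -> R.
Variable H : nat.
Hypothesis holes : forall w, w \in S -> (H <= #|[set z | ~~ occ w z]|)%N.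
Implicit Types (x y z : T).
Local Notation swap_en := (swap_energy S f).
Local Notation jump_en := (jump_energy S f).
Local Notation en := (energy to S f).

Definition tag_swap_energy x y : R := en (fun w => tag w == x) (tperm x y).

(** The particle at y moves to the hole at z, the tag to y, and the particle to x
in its place. *)
Lemma tag_swap_via x y z : x != y ->
  en (hole_at x z) (tperm x y) ^+ 2 <= 3 * (swap_en y z ^+ 2 + jump_en x y ^+ 2 + swap_en x z ^+ 2).
Proof.
move=> xy; have [a0 b0 c0] := And3 (swap_energy_ge0 S f y z) (jump_energy_ge0 S f x y) (swap_energy_ge0 S f x z).
suff : en (hole_at x z) (tperm x y) <= swap_en y z + jump_en x y + swap_en x z.
  move: (swap_en y z) (jump_en x y) (swap_en x z) a0 b0 c0 => a b c a0 b0 c0 le_en.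
  apply: (@le_trans _ _ ((a + b + c) ^+ 2)).
    by rewrite ler_pXn2r ?nnegrE ?energy_ge0 ?addr_ge0.
  rewrite -subr_ge0 (_ : _ - _ = (a - b) ^+ 2 + (a - c) ^+ 2 + (b - c) ^+ 2).
    by rewrite !addr_ge0 ?sqr_ge0.
  by ring.
have [->|yz] := eqVneq z y; first by rewrite -addrA addrCA lerDl addr_ge0 ?swap_energy_ge0.
have [->|zx] := eqVneq z x.
  rewrite [en _ _](_ : _ = 0) ?addr_ge0 ?energy_ge0 //.
  rewrite /energy big_pred0 ?sqrtr0 // => w; rewrite /hole_at.
  by case: eqP => [<-|_]; rewrite ?occ_tag andbF.
have -> : tperm x y = (tperm y z * (tperm x y * tperm x z))%g.
  have -> : (tperm x y * tperm x z = tperm y z * tperm x y)%g.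
    by rewrite [RHS]conjgC tpermJ tpermR tpermD // eq_sym.
  by rewrite mulgA tperm2 mul1g.
have fix_x : tperm y z x = x by rewrite tpermD // eq_sym.
rewrite -addrA.
have swap (P : pred (tagged T)) u v : (forall w, P w -> (tag w != u) && (tag w != v)) ->
    en P (tperm u v) <= swap_en u v.
  by move=> Puv; apply: energy_sub => w /Puv.
apply: le_trans (energy_mul S_inv f (Q := hole_at x y) _ _) (lerD (swap _ _ _ _) _).
- move=> w /andP[/eqP tw hw].
  by rewrite /hole_at tag_move tw fix_x eqxx occ_moveV tpermV tpermL.
- by move=> w /andP[/eqP-> _]; rewrite xy eq_sym.
apply: le_trans (energy_mul S_inv f (Q := fun w => tag w == y) _ _) (lerD (lexx _) (swap _ _ _ _)).
- by move=> w /andP[/eqP tw hw]; rewrite tag_move tw tpermL.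
- by move=> w /eqP->; rewrite eq_sym xy eq_sym.
Qed.

(** Average [tag_swap_via] over all holes of the configuration. *)
Lemma tag_swap_le x y : x != y ->
  H%:R * tag_swap_energy x y ^+ 2
   <= 3 * \sum_z (swap_en y z ^+ 2 + jump_en x y ^+ 2 + swap_en x z ^+ 2).
Proof.
move=> xy; rewrite mulr_sumr; apply: le_trans (ler_sum _ (fun z _ => tag_swap_via z xy)).
under eq_bigr do rewrite sqr_energy big_mkcondr /=.
rewrite sqr_energy mulr_sumr exchange_big /= big_mkcondr /=.
apply: ler_sum => w wS; case: ifP => tw; last by rewrite sumr_ge0 // => z _; case: ifP => // _; exact: sqr_ge0.
rewrite -big_mkcond sumr_const -[leRHS]mulr_natl ler_wpM2r ?sqr_ge0 // ler_nat.
apply: leq_trans (holes wS) _; rewrite subset_leq_card //.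
by apply/subsetP => z; rewrite !inE unfold_in /hole_at tw.
Qed.

Lemma exchange_energy_le Es Ej :
    \sum_x \sum_y swap_en x y ^+ 2 <= Es -> \sum_x \sum_y jump_en x y ^+ 2 <= Ej ->
  H%:R * transposition_energy to S setT f <= H%:R * Es + 6 * #|T|%:R * (2 * Es + Ej).
Proof.
move=> le_s le_j.
pose tagE x y : R := if x == y then 0 else tag_swap_energy x y ^+ 2.
have E : transposition_energy to S setT f <= \sum_x \sum_y swap_en x y ^+ 2 + 2 * \sum_x \sum_y tagE x y.
  have -> : 2 * (\sum_x \sum_y tagE x y) = \sum_x \sum_y (tagE x y + tagE y x).
    under [RHS]eq_bigr do rewrite big_split /=.
    by rewrite big_split /= [X in _ + X]exchange_big /=; ring.
  have -> : transposition_energy to S setT f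
      = \sum_x \sum_y \sum_(w in S) (f (to w (tperm x y)) - f w) ^+ 2.
    apply: eq_big => x; first by rewrite inE.
    by move=> _; apply: eq_bigl => y; rewrite inE.
  rewrite -big_split; apply: ler_sum => x _; rewrite -big_split; apply: ler_sum => y _ /=.
  rewrite /tagE eq_sym; case: eqVneq => [->|xy].
    rewrite tperm1 big1 ?addr_ge0 ?sqr_ge0 // => w _.
    by rewrite move1 subrr expr0n.
  rewrite (bigID (fun w => (tag w != x) && (tag w != y))) /=.
  rewrite /swap_energy /tag_energy /tag_swap_energy !sqr_energy; apply: lerD => //.
  rewrite (bigID (fun w => tag w == x)) /=; apply: lerD.
    rewrite [leRHS](eq_bigl (fun w => (w \in S) && ~~ ((tag w != x) && (tag w != y)) && (tag w == x))) //.
    by move=> w; case: (tag w == x); rewrite ?andbF ?andbT.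
  rewrite [tperm y x]tpermC.
  rewrite [leRHS](eq_bigl (fun w => (w \in S) && ~~ ((tag w != x) && (tag w != y)) && (tag w != x))) //.
  move=> w; have [->|] := eqVneq (tag w) x; rewrite ?andbF ?andbT //=.
    by rewrite [x == y]eq_sym (negPf xy) andbF.
  by rewrite negbK.
apply: le_trans (ler_wpM2l _ E) _ => //; rewrite mulrDr lerD ?ler_wpM2l //.
have -> : H%:R * (2 * \sum_x \sum_y tagE x y) = 2 * \sum_x \sum_y H%:R * tagE x y.
  by rewrite mulrCA mulr_sumr; congr (_ * _); apply: eq_bigr => x _; rewrite mulr_sumr.
rewrite (_ : 6 * _ * _ = 2 * (3 * (#|T|%:R * Es + #|T|%:R * Ej + #|T|%:R * Es))); last by ring.
rewrite ler_pM2l //.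
apply: (@le_trans _ _ (\sum_x \sum_y 3 * \sum_z (swap_en y z ^+ 2 + jump_en x y ^+ 2 + swap_en x z ^+ 2))).
  apply: ler_sum => x _; apply: ler_sum => y _.
  rewrite /tagE; case: eqVneq => [_|xy]; last exact: tag_swap_le.
  by rewrite !mulr0 mulr_ge0 // sumr_ge0 // => z _; rewrite !addr_ge0 ?sqr_ge0.
under eq_bigr do rewrite -mulr_sumr.
rewrite -mulr_sumr ler_pM2l //.
have -> : \sum_x \sum_y \sum_z (swap_en y z ^+ 2 + jump_en x y ^+ 2 + swap_en x z ^+ 2)
    = (\sum_x \sum_y swap_en x y ^+ 2) *+ #|T| + (\sum_x \sum_y jump_en x y ^+ 2) *+ #|T|
      + (\sum_x \sum_y swap_en x y ^+ 2) *+ #|T|.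
  have E1 : \sum_(x : T) \sum_y \sum_z swap_en y z ^+ 2
      = (\sum_x \sum_y swap_en x y ^+ 2) *+ #|T| by rewrite sumr_const.
  have E2 : \sum_x \sum_y \sum_(z : T) jump_en x y ^+ 2
      = (\sum_x \sum_y jump_en x y ^+ 2) *+ #|T|.
    rewrite -sumrMnl; apply: eq_bigr => x _.
    by rewrite -sumrMnl; apply: eq_bigr => y _; rewrite sumr_const.
  have E3 : \sum_x \sum_(y : T) \sum_z swap_en x z ^+ 2
      = (\sum_x \sum_y swap_en x y ^+ 2) *+ #|T|.
    by rewrite -sumrMnl; apply: eq_bigr => x _; rewrite sumr_const.
  rewrite -{1}E1 -E2 -E3 -!big_split; apply: eq_bigr => x _ /=.
  rewrite -!big_split; apply: eq_bigr => y _ /=.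
  by rewrite !big_split.
by rewrite !lerD // -[leLHS]mulr_natl ler_wpM2l.
Qed.

End ExchangeEnergy.

(** * Permutations act transitively on the canonical states *)

Section Transitive.
Variable T : finType.
Local Notation to := (move_action T).
Implicit Types w : tagged T.

(** Two configurations with as many particles have the same occupation pattern
along this list, so matching their lists site by site gives a permutation from
one to the other. *)
Definition site_list w : seq T :=
  tag w :: [seq z <- enum T | occ w z && (z != tag w)] ++ [seq z <- enum T | ~~ occ w z].

Lemma site_list_perm w : perm_eq (site_list w) (enum T).
Proof.
have uE (P : pred T) : uniq [seq z <- enum T | P z] by rewrite filter_uniq ?enum_uniq.
apply: uniq_perm; rewrite ?enum_uniq //.
  rewrite cons_uniq mem_cat !mem_filter eqxx andbF occ_tag /= cat_uniq !uE andbT /=.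
  by apply/hasPn => z; rewrite !mem_filter => /andP[/negPf->].
move=> z; rewrite inE mem_cat 2!mem_filter mem_enum !andbT.
by case: eqP => [->//|_]; rewrite andbT orbN.
Qed.

Lemma occ_site_list w :
  [seq occ w z | z <- site_list w]
   = nseq #|[set z | occ w z]| true ++ nseq #|[set z | ~~ occ w z]| false.
Proof.
have const b (s : seq T) : all (fun z => occ w z == b) s -> [seq occ w z | z <- s] = nseq (size s) b.
  by elim: s => //= z s IH /andP[/eqP-> /IH->].
rewrite /= map_cat occ_tag (const true); last first.
  by apply/allP => z; rewrite mem_filter => /andP[/andP[->]].
rewrite (const false); last by apply/allP => z; rewrite mem_filter => /andP[/negPf->].
have sizeE (P : pred T) : size [seq z <- enum T | P z] = #|[set z | P z]|.
  have uE : uniq [seq z <- enum T | P z] by rewrite filter_uniq ?enum_uniq.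
  rewrite -(card_uniqP uE).
  by apply: eq_card => z; rewrite mem_filter mem_enum !inE andbT.
rewrite -cat_cons -[true :: nseq _ _]/(nseq _.+1 true) !sizeE.
congr (nseq _ _ ++ _); rewrite (cardsD1 (tag w) [set z | occ w z]) inE occ_tag add1n; congr S.
by apply: eq_card => z; rewrite !inE andbC.
Qed.

Lemma move_transitive w w' : #|[set z | occ w z]| = #|[set z | occ w' z]| ->
  exists s, to w s = w'.
Proof.
move=> cww'.
have chole : #|[set z | ~~ occ w z]| = #|[set z | ~~ occ w' z]|.
  have E (v : tagged T) : #|[set z | ~~ occ v z]| = (#|T| - #|[set z | occ v z]|)%N.
    rewrite [LHS]cardsCs (_ : ~: _ = [set z | occ v z]) //.
    by apply/setP => z; rewrite !inE negbK.
  by rewrite !E cww'.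
pose s := site_list w; pose s' := site_list w'.
have sz v : size (site_list v) = #|T| by rewrite (perm_size (site_list_perm v)) -cardE.
have mem v z : z \in site_list v by rewrite (perm_mem (site_list_perm v)) mem_enum.
have un v : uniq (site_list v) by rewrite (perm_uniq (site_list_perm v)) enum_uniq.
pose g z := nth z s' (index z s).
have idx z : (index z s < size s')%N by rewrite sz -(sz w) index_mem mem.
have g_inj : injective g.
  move=> x y; rewrite /g (set_nth_default x (s := s') y) // => /eqP.
  rewrite nth_uniq //; last exact: un.
  move=> /eqP/(congr1 (nth x s)).
  by rewrite !nth_index //; exact: mem.
have g_occ z : occ w' (g z) = occ w z.
  have E : [seq occ w z | z <- s] = [seq occ w' z | z <- s'].
    by rewrite /s /s' !occ_site_list cww' chole.
  rewrite -[in RHS](nth_index z (mem w z)) -/s /g -(nth_map z false) // -E (nth_map z) //.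
  by rewrite index_mem; apply: mem.
exists (perm g_inj); apply: tagged_eq => [|z].
  by rewrite tag_move permE /g /s /= eqxx.
by rewrite -[in LHS](permKV (perm g_inj) z) occ_move -g_occ -[in RHS](permKV (perm g_inj) z) permE.
Qed.

End Transitive.

(** * The Dirichlet form of the exclusion process *)

Section Swap.
Variables (d l : nat).
Local Notation T := (box d l).

Lemma swap_siteE (x y z : T) : swap_site [set x; y] z = tperm x y z.
Proof.
rewrite /swap_site; case: pickP => [u /eqP/setP E|none].
  have := E y; have := E x; have := E u; rewrite !inE !eqxx !orbT.
  case: tpermP => [->|->|/eqP zx /eqP zy].
  - by case/orP => /eqP-> // _; rewrite orbb => /esym/eqP.
  - by case/orP => /eqP-> //; rewrite orbb => /esym/eqP.
  by have := E z; rewrite !inE eqxx (negPf zx) (negPf zy).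
case: tpermP => // [zx|zy]; first by have := none y; rewrite zx eqxx.
by have := none x; rewrite zy setUC eqxx.
Qed.

Lemma swap_OmegaE (x y : T) (w : Omega d l) :
  swap_Omega [set x; y] w = move_action T (w : tagged T) (tperm x y).
Proof.
apply: (@tagged_eq T) => [|z].
  by rewrite tag_move -swap_siteE.
by rewrite occ_moveV tpermV -swap_siteE /occ /= ffunE.
Qed.

End Swap.

Section Dirichlet.
Variables (R : realType) (d l : nat).
Local Notation T := (box d l).
Local Notation to := (move_action T).
Variable S : {set tagged T}.
Variable f : tagged T -> R.

Definition dirichlet : R := \sum_(e in edges R d l) \sum_(w in S)
  exch_rate R e (val (w : Omega d l)).2 * (f (swap_Omega e w) - f w) ^+ 2.

Lemma edge_energyE (x y : T) : edge_energy S f x y ^+ 2 = \sum_(w in S)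
  exch_rate R [set x; y] (val (w : Omega d l)).2 * (f (swap_Omega [set x; y] w) - f w) ^+ 2.
Proof.
rewrite sqr_energy big_mkcondr /=; apply: eq_bigr => w _.
rewrite swap_OmegaE /exch_rate.
suff -> : (swap_config [set x; y] (val w).2 != (val w).2) = (occ w x != occ w y).
  by case: (occ w x != occ w y); rewrite ?mul1r ?mul0r.
congr (~~ _); apply/eqP/eqP => [/ffunP/(_ x)|eq_occ].
  by rewrite ffunE swap_siteE tpermL.
apply/ffunP => z; rewrite ffunE swap_siteE.
by case: tpermP => [->|->|].
Qed.

(** Each unoriented edge is seen from both of its ends. *)
Lemma sum_site_energy : \sum_x site_energy S f x <= 2 * dirichlet.
Proof.
pose g (e : {set T}) : R := \sum_(w in S)
  exch_rate R e (val (w : Omega d l)).2 * (f (swap_Omega e w) - f w) ^+ 2.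
have g0 e : 0 <= g e by apply: sumr_ge0 => w _; rewrite mulr_ge0 ?sqr_ge0 // /exch_rate.
have -> : \sum_x site_energy S f x = \sum_(p : T * T | eucl_dist R p.1 p.2 == 1) g [set p.1; p.2].
  rewrite /site_energy pair_big_dep /=; apply: eq_bigr => p _.
  exact: edge_energyE.
rewrite (partition_big (fun p => [set p.1; p.2]) (mem (edges R d l))) /=; last first.
  by move=> p p1; apply/imsetP; exists p; rewrite ?inE.
rewrite mulr_sumr; apply: ler_sum => e /imsetP[[a b] _ def_e].
rewrite (eq_bigr (fun=> g e)); last by move=> p /andP[_ /eqP->].
rewrite sumr_const -[_ *+ _]mulr_natl ler_wpM2r // ler_nat.
apply: (@leq_trans #|[set (a, b); (b, a)]|); last by rewrite cards2; case: (_ != _).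
apply: subset_leq_card; apply/subsetP => -[x y] /andP[_ /eqP] /=.
rewrite def_e => /setP E; have := E x; have := E y; have := E a; have := E b.
rewrite !inE !eqxx !orbT /= !xpair_eqE => Eb Ea /esym Ey /esym Ex.
case/orP: Ex Ea Eb => /eqP->; case/orP: Ey => /eqP->; rewrite !eqxx ?orbT ?orbb //=.
  by rewrite [b == a]eq_sym => _ ->.
by rewrite [a == b]eq_sym => ->.
Qed.

End Dirichlet.

(** * The uniform measure on the canonical states *)

Section Canonical.
Variables (R : realType) (d l : nat) (rho : R).
Local Notation T := (box d l).
Local Notation to := (move_action T).
Local Notation S := (canonical_states d l rho : {set tagged T}).

Lemma canonicalE (w : tagged T) :
  (w \in S) = (#|[set z | occ w z]|%:Z == particle_number d l rho).
Proof.
rewrite inE; congr (_%:Z == _).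
rewrite -[RHS]sum1_card [RHS]big_mkcond /=; apply: eq_bigr => z _.
by rewrite inE; case: (occ w z).
Qed.

Lemma canonical_inv w s : (to w s \in S) = (w \in S).
Proof.
rewrite !canonicalE; congr (_%:Z == _).
rewrite -(card_imset [set z | occ w z] (@perm_inj _ s)); apply: eq_card => z.
rewrite inE; apply/idP/imsetP => [|[y]].
  rewrite occ_moveV => h; exists (s^-1 z)%g; rewrite ?inE ?permKV //.
by rewrite inE => h ->; rewrite occ_move.
Qed.

(** By transitivity the average over all permutations is constant on the canonical
states; being self-adjoint, it preserves the expectation. *)
Lemma mean_expect f w : w \in S -> sym_mean to setT f w = expect rho f.
Proof.
move=> wS; have S0 : #|S|%:R != 0 :> R.
  by rewrite pnatr_eq0 -lt0n; apply/card_gt0P; exists w.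
have const v : v \in S -> sym_mean to setT f v = sym_mean to setT f w.
  move: wS; rewrite !canonicalE => /eqP <- /eqP[cvw].
  have [s <-] := move_transitive cvw.
  by rewrite sym_mean_act // inE; apply/subsetP => x _; rewrite inE.
apply: (mulfI S0); rewrite /expect [RHS]mulrCA mulfV // mulr1.
transitivity (\sum_(v in S) sym_mean to setT f v * 1).
  rewrite (eq_bigr (fun=> sym_mean to setT f w)); last by move=> v /const->; rewrite mulr1.
  by rewrite sumr_const mulr_natl.
rewrite (sym_mean_adj canonical_inv setT f (fun=> 1)).
by apply: eq_bigr => v _; rewrite sym_mean_id // mulr1.
Qed.

Lemma card_holes (w : tagged T) :
  #|[set z | ~~ occ w z]| = (#|T| - #|[set z | occ w z]|)%N.
Proof.
rewrite [LHS]cardsCs (_ : ~: _ = [set z | occ w z]) //.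
by apply/setP => z; rewrite !inE negbK.
Qed.

Lemma eq_canonical_holes (w w' : tagged T) : w \in S -> w' \in S ->
  #|[set z | ~~ occ w z]| = #|[set z | ~~ occ w' z]|.
Proof. by rewrite !canonicalE !card_holes => /eqP <- /eqP[->]. Qed.

Lemma canonical_holes (w : tagged T) : w \in S ->
  (1 - rho) * #|T|%:R <= #|[set z | ~~ occ w z]|%:R.
Proof.
rewrite canonicalE card_holes => /eqP cw.
rewrite natrB ?max_card // mulrBl mul1r lerD2l lerN2.
have := floor_le (rho * #|T|%:R).
by rewrite -/(particle_number d l rho) -cw.
Qed.

End Canonical.

(** The numerical end of the argument: n is the number of sites, h the number of
holes, q = 1 - rho, X the variance, E the energy of all transpositions, L2 the
square of the side of the box and l2 the one of its radius, P the local
energies and D the Dirichlet form. *)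
Lemma combine_bounds (R : realFieldType) (q n h c L2 l2 P D X E : R) :
    0 < q -> 0 < n -> 0 <= c -> 0 <= L2 -> L2 <= 9 * l2 -> 0 <= P -> P <= 2 * D -> 0 <= X ->
    q * n <= h -> h <= n -> 4 * n * X <= E ->
    h * E <= h * (c * (363 * (n * L2 * P))) + 6 * n * (2 * (c * (363 * (n * L2 * P)))
       + 20 * (c * (363 * (n * L2 * P)))) ->
  X <= 133 * 363 * 5 * c / q * l2 * D.
Proof.
move=> q0 n0 c0 L20 L2l P0 PD X0 qn hn nX hE.
have h0 : 0 < h by apply: lt_le_trans qn; rewrite mulr_gt0.
set B := c * (363 * (n * L2 * P)) in hE.
have B0 : 0 <= B by rewrite /B !mulr_ge0 // ltW.
have s1 : n * (4 * (h * X)) <= n * (133 * B).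
  rewrite (_ : n * (4 * (h * X)) = h * (4 * n * X)); last by ring.
  apply: le_trans (ler_wpM2l (ltW h0) nX) _; apply: le_trans hE _.
  have hB : h * B <= n * B by rewrite ler_wpM2r.
  rewrite -subr_ge0 (_ : _ - _ = n * B - h * B); last by ring.
  by rewrite subr_ge0.
have {}s1 : 4 * (h * X) <= 133 * B by rewrite ler_pM2l in s1.
have s2 : n * (4 * (q * X)) <= n * (133 * 363 * (c * (L2 * P))).
  rewrite (_ : n * (4 * (q * X)) = 4 * (q * n * X)); last by ring.
  rewrite (_ : n * (_ * _ * _) = 133 * B); last by rewrite /B; ring.
  by apply: le_trans s1; rewrite ler_pM2l // ler_wpM2r.
have {}s2 : 4 * (q * X) <= 133 * 363 * (c * (L2 * P)) by rewrite ler_pM2l in s2.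
have s3 : c * (L2 * P) <= c * (9 * l2 * (2 * D)).
  by rewrite ler_wpM2l // ler_pM.
have Dc : 0 <= c * (l2 * D).
  have l20 : 0 <= l2 by lra.
  by rewrite !mulr_ge0 //; lra.
rewrite (_ : 133 * 363 * 5 * c / q * l2 * D = 133 * 363 * 5 * (c * (l2 * D)) / q); last by ring.
rewrite ler_pdivlMr //.
rewrite (_ : c * (9 * l2 * (2 * D)) = 18 * (c * (l2 * D))) in s3; last by ring.
by move: (c * (l2 * D)) (c * (L2 * P)) Dc s2 s3 => u v; rewrite mulrC; lra.
Qed.

Theorem theorem3p1 (R : realType) (d : nat) (hd : (2 <= d)%N) :
  exists C_S : R -> R,
    (forall r s : R, 0 < r -> r < s -> s < 1 -> C_S r < C_S s) /\
    (forall rho : R, 0 < rho -> rho < 1 ->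
     forall l : nat, (1 <= l)%N -> 1 <= particle_number d l rho ->
     forall f : Omega d l -> R,
       expect rho (fun w => (f w - expect rho f) ^+ 2)
       <= C_S rho * l%:R ^+ 2 *
          \sum_(e in edges R d l)
            expect rho (fun w => exch_rate R e (val w).2 *
                                 (f (swap_Omega e w) - f w) ^+ 2)).
Proof.
(* 133 = 1 + 6 * (2 + 20) from [exchange_energy_le] and [box_energy_sum], 363 from
   [line_bound]; the factor 2 of [sum_site_energy], the 9 of (2 l + 1)^2 <= 9 l^2
   and the 1/4 of [transposition_gap] combine into 9/2 <= 5 *)
exists (fun rho => 133 * 363 * 5 * 40 ^+ d / (1 - rho)); split.
  move=> r s _ rs s1; rewrite ltr_pM2l ?mulr_gt0 ?exprn_gt0 //.
  by rewrite ltf_pV2 ?posrE; lra.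
move=> rho _ rho1 l l1 _ f.
pose S : {set tagged (box d l)} := canonical_states d l rho.
have S_inv : forall w s, (move_action (box d l) w s \in S) = (w \in S) by exact: canonical_inv.
rewrite -mulr_suml mulrA /expect ler_wpM2r ?invr_ge0 //.
rewrite -/(dirichlet S f) -/S -/(expect rho f).
have D0 : 0 <= dirichlet S f.
  do 2 (apply: sumr_ge0 => ? _); rewrite mulr_ge0 ?sqr_ge0 //; exact: ler0n.
have r0 : 0 < 1 - rho by lra.
have [S0|[w0 w0S]] := set_0Vmem S.
  rewrite big1 => [|w]; last by rewrite S0 inE.
  by rewrite !mulr_ge0 ?exprn_ge0 ?invr_ge0 // ltW.
rewrite (eq_bigr (fun w => (f w - sym_mean (move_action (box d l)) setT f w) ^+ 2)); last first.
  by move=> w wS; rewrite (mean_expect f wS).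
pose H := #|[set z | ~~ occ (w0 : tagged (box d l)) z]|.
have holes w : w \in S -> (H <= #|[set z | ~~ occ w z]|)%N.
  by move=> wS; rewrite /H (eq_canonical_holes w0S wS).
have [swap_le jump_le] := box_energy_sum hd l1 S_inv f.
have ex := exchange_energy_le S_inv holes swap_le jump_le.
have gap := transposition_gap S_inv setT f.
rewrite cardsT in gap.
apply: (combine_bounds r0 _ _ _ _ _ (sum_site_energy S f) _ (canonical_holes w0S) _ gap ex).
- by rewrite ltr0n; apply/card_gt0P; exists (tag (w0 : tagged (box d l))).
- exact: exprn_ge0.
- exact: exprn_ge0.
- rewrite (_ : 9 = 3 ^+ 2 :> R); last by ring.
  rewrite -exprMn ler_pXn2r ?nnegrE ?mulr_ge0 // -natrM ler_nat; lia.
- exact: site_sum_ge0.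
- by apply: sumr_ge0 => w _; apply: sqr_ge0.
- by rewrite ler_nat max_card.
Qed.
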